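(* Consider the learning process (beliefs $\mu_i^{(t)}$, strategies $x_i^{(t)}$, costs $y_i^{(t)}$) described in the context. Suppose that: (1) there is a constant $L>0$ with $\max_i\max_{\theta',\theta''\in\Theta}\max_{x\in\mathcal X}\sup_{y_i}\left|\log\frac{f_i(y_i|x,\theta')}{f_i(y_i|x,\theta'')}\right|\le L$, and for each $i\in\mathcal N$ and each $\theta\in\Theta$, $f_i(y_i|x,\theta)$ is continuous in $x$; (2) the undirected graph $\mathcal G(\mathcal N,\mathcal E)$ is connected and $W$ is doubly stochastic, i.e. $\sum_{j=1}^N w_{ij}=\sum_{i=1}^N w_{ij}=1$; (3) $0<\alpha^{(t)}<1$, $\sum_{t=0}^\infty\alpha^{(t)}=\infty$ and $\sum_{t=0}^\infty(\alpha^{(t)})^2<\infty$. Then there is a common (random) belief $\mu\in\Delta(\Theta)$ such that, for every agent $i\in\mathcal N$, the belief sequence $\{\mu_i^{(t)}\}_{t\ge0}$ converges almost surely to $\mu$, and $$\mu(\theta_k)=\frac{\nu_k}{\sum_{l=1}^M\nu_l},\qquad k=1,\dots,M,$$ where $\nu_k$ is the non-negative random variable to which $\frac1N\sum_{i=1}^N\frac{\mu_i^{(t)}(\theta_k)}{\mu_i^{(t)}(\theta^* )}$ converges with probability $1$ as $t\to\infty$.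
   Context: Game. $\mathcal N=\{1,\dots,N\}$ is the set of agents. Agent $i$ has a strategy $x_i$ in a convex compact set $\mathcal X_i$ (in a Euclidean space); $\mathcal X=\prod_i\mathcal X_i$, $x=(x_1,\dots,x_N)$, and $x_{-i}$ denotes the strategies of all agents except $i$. $\Theta=\{\theta_1,\dots,\theta_M\}$ is a finite parameter set and $\theta^*\in\Theta$ is the (unknown) true parameter. $\Delta(\Theta)$ is the set of probability distributions on $\Theta$. The cost functions are $u_i:\mathcal X\times\Theta\to\mathbb R$. Given $x$ and $\theta$, the realized cost of agent $i$ is $y_i=u_i(x,\theta)+\epsilon_i(x,\theta)$ with zero-mean noise $\epsilon_i(x,\theta)$; its probability density (likelihood function) is $f_i(y_i|x,\theta)$, which is positive on the set of values of $y_i$ over which suprema over $y_i$ are taken. For $\mu\in\Delta(\Theta)$ let $u_i(x,\mu)=\sum_{\theta\in\Theta}\mu(\theta)u_i(x,\theta)$ and $\mathrm{BR}_i(x_{-i},\mu)=\arg\min_{x_i\in\mathcal X_i}u_i(x_i,x_{-i},\mu)$. Network. $\mathcal G(\mathcal N,\mathcal E)$ is an undirected graph with node set $\mathcal N$ and edge set $\mathcal E$, $\mathcal N_i=\{j\in\mathcal N:(j,i)\in\mathcal E\}$ is the set of neighbors of $i$, and $W=[w_{ij}]\in\mathbb R^{N\times N}$ is a non-negative weight matrix with $w_{ij}>0$ if and only if $j\in\mathcal N_i$. Learning process. Let $\{\alpha^{(t)}\}_{t\ge0}$ be a non-increasing non-negative step-size sequence. Initialize $x_i^{(0)}\in\mathcal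 X_i$ and $\mu_i^{(0)}(\theta_k)=1/M$ for all $i,k$. At each time $t=0,1,2,\dots$: conditionally on the past and on $x^{(t)}$, the costs $(y_1^{(t)},\dots,y_N^{(t)})$ are drawn from the product density $\prod_{j=1}^N f_j(y_j|x^{(t)},\theta^* )$; then for each $i\in\mathcal N$ and $k=1,\dots,M$, $$b_i^{(t)}(\theta_k)=\frac{f_i(y_i^{(t)}|x^{(t)},\theta_k)^{\alpha^{(t)}}\mu_i^{(t)}(\theta_k)}{\sum_{\theta\in\Theta}f_i(y_i^{(t)}|x^{(t)},\theta)^{\alpha^{(t)}}\mu_i^{(t)}(\theta)},\qquad \mu_i^{(t+1)}(\theta_k)=\frac{\exp\big(\sum_{j=1}^N w_{ij}\log b_j^{(t)}(\theta_k)\big)}{\sum_{\theta\in\Theta}\exp\big(\sum_{j=1}^N w_{ij}\log b_j^{(t)}(\theta)\big)},$$ $$x_i^{(t+1)}\in(1-\alpha^{(t)})x_i^{(t)}+\alpha^{(t)}\mathrm{BR}_i(x_{-i}^{(t)},\mu_i^{(t+1)}).$$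
   Formalization: The graph is additionally assumed not bipartite (a self-loop suffices, e.g. if each agent is its own neighbor); otherwise the claim can fail, e.g. for two agents with W the swap matrix, whose beliefs may oscillate. *)

(* Defs.v *)
From HB Require Import structures.
From mathcomp Require Export all_boot all_order all_algebra.
From mathcomp Require Export all_classical all_reals all_analysis.
Export Order.TTheory GRing.Theory Num.Theory.
Export numFieldNormedType.Exports.

Set Implicit Arguments.
Unset Strict Implicit.
Unset Printing Implicit Defensive.

Local Open Scope classical_set_scope.
Local Open Scope ring_scope.

Section Game.
Context {R : realType} {N : nat} {n : 'I_N -> nat} {Theta : finType}.

Definition profile : Type := prod_topology (fun i : 'I_N => 'rV[R]_(n i)).

Definition profiles (X : forall i : 'I_N, set 'rV[R]_(n i)) : set profile :=
  [set x | forall i, X i (x i)].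

Definition beliefs : set (Theta -> R) :=
  [set m | (forall k, 0 <= m k) /\ \sum_k m k = 1].

Definition expected_cost (u : 'I_N -> profile -> Theta -> R)
    (i : 'I_N) (x : profile) (m : Theta -> R) : R :=
  \sum_k m k * u i x k.

(* [dfwith x i z] is [x] with the strategy of agent [i] replaced by [z], so that
   [best_response] only depends on the strategies of the other agents. *)
Definition best_response (X : forall i : 'I_N, set 'rV[R]_(n i))
    (u : 'I_N -> profile -> Theta -> R)
    (i : 'I_N) (x : profile) (m : Theta -> R) : set 'rV[R]_(n i) :=
  [set z | X i z /\ forall z', X i z' ->
     expected_cost u i (dfwith x i z) m <= expected_cost u i (dfwith x i z') m].

(* [f i v x k] is the likelihood of the cost value [v]. *)
Definition cost_values (f : 'I_N -> R -> profile -> Theta -> R)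
    (i : 'I_N) (x : profile) : set R :=
  [set v | exists k, 0 < f i v x k].

(* The law of [u i x k + noise] has density [f i ^~ x k]; the noise having
   mean zero amounts to this law having mean [u i x k]. *)
Definition cost_densities (X : forall i : 'I_N, set 'rV[R]_(n i))
    (u : 'I_N -> profile -> Theta -> R)
    (f : 'I_N -> R -> profile -> Theta -> R) : Prop :=
  forall i x k, profiles X x ->
  [/\ measurable_fun setT (fun v => f i v x k),
      forall v, 0 <= f i v x k,
      (\int[lebesgue_measure]_v (f i v x k)%:E = 1)%E,
      lebesgue_measure.-integrable setT (fun v => (v * f i v x k)%:E)
    & (\int[lebesgue_measure]_v (v * f i v x k)%:E = (u i x k)%:E)%E ].

Definition log_likelihood_bound (X : forall i : 'I_N, set 'rV[R]_(n i))
    (f : 'I_N -> R -> profile -> Theta -> R) (L : R) : Prop :=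
  forall i k k' x v, profiles X x -> cost_values f i x v ->
    `| ln (f i v x k / f i v x k') | <= L.

End Game.

Arguments profile R {N} n.
Arguments beliefs R Theta : clear implicits.
Arguments best_response {R N n Theta} X u i x m.

Section Network.
Context {R : realType} {N : nat}.

Definition weight_matrix (E : rel 'I_N) (W : 'M[R]_N) : Prop :=
  (forall i j, 0 <= W i j) /\ (forall i j, 0 < W i j <-> E j i).

Definition doubly_stochastic (W : 'M[R]_N) : Prop :=
  (forall i, \sum_j W i j = 1) /\ (forall j, \sum_i W i j = 1).

Definition connected_graph (E : rel 'I_N) : Prop := forall i j, connect E i j.

(* Loops count as edges, so a graph in which some agent is its own neighbor is
   not bipartite. For a connected graph, not being bipartite is what makes the
   weight matrix aperiodic. *)
Definition bipartite (E : rel 'I_N) : Prop :=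
  exists c : 'I_N -> bool, forall i j, E i j -> c i != c j.

End Network.

Section Learning.
Context {R : realType} {N : nat} {n : 'I_N -> nat} {Theta : finType}.
Context {d : measure_display} {Omega : measurableType d}.
Variable P : probability Omega R.
Variables (X : forall i : 'I_N, set 'rV[R]_(n i))
          (u : 'I_N -> profile R n -> Theta -> R)
          (f : 'I_N -> R -> profile R n -> Theta -> R)
          (W : 'M[R]_N) (alpha : nat -> R).
Variables (x : nat -> Omega -> profile R n) (y : nat -> 'I_N -> Omega -> R)
          (mu : nat -> 'I_N -> Omega -> Theta -> R).

(* The sigma-algebra generated by x^(0), ..., x^(t) and y^(0), ..., y^(t-1);
   the beliefs up to time t are functions of these. *)
Definition history (t : nat) : set_system Omega :=
  <<s [set A | (exists s i k B, [/\ (s <= t)%N, measurable B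
                 & A = (fun w => x s w i 0 k) @^-1` B])
            \/ (exists s i B, [/\ (s < t)%N, measurable B
                 & A = y s i @^-1` B]) ] >>.

(* Conditionally on [history t], the family [y t] has the product density
   \prod_j f j (v_j) (x^(t)) ts. By a pi-lambda argument it is enough to test
   the conditional law on measurable boxes. *)
Definition costs_drawn (ts : Theta) : Prop :=
  forall (t : nat) (A : set Omega) (B : 'I_N -> set R),
    history t A -> (forall j, measurable (B j)) ->
    (P (A `&` [set w | forall j, B j (y t j w)]) =
     \int[P]_(w in A)
        (\prod_j \int[lebesgue_measure]_(v in B j) f j v (x t w) ts)%R%:E)%E.

Definition posterior (t : nat) (i : 'I_N) (w : Omega) (k : Theta) : R :=
  f i (y t i w) (x t w) k `^ alpha t * mu t i w k /
  \sum_l f i (y t i w) (x t w) l `^ alpha t * mu t i w l.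

Definition pooled (t : nat) (i : 'I_N) (w : Omega) (k : Theta) : R :=
  expR (\sum_j W i j * ln (posterior t j w k)).

Record learning_process (ts : Theta) : Prop := LearningProcess {
  strategy_measurable : forall t i k,
    measurable_fun setT (fun w => x t w i 0 k);
  cost_measurable : forall t i, measurable_fun setT (y t i);
  strategy_init : forall w, profiles X (x 0%N w);
  belief_init : forall i w k, mu 0%N i w k = #|Theta|%:R^-1;
  cost_law : costs_drawn ts;
  belief_update : forall t i w k,
    mu t.+1 i w k = pooled t i w k / \sum_l pooled t i w l;
  strategy_update : forall t i w,
    exists2 z, best_response X u i (x t w) (mu t.+1 i w) z
      & x t.+1 w i = (1 - alpha t) *: x t w i + alpha t *: z
}.

End Learning.

(* Main.v *)
Require Import Defs.
From HB Require Import structures.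
From mathcomp Require Import measurable_realfun lra.

(** Fix a parameter [k] and follow the ratio of each agent's belief in [k] to her
    belief in the true parameter [ts]. Bayes' rule multiplies this ratio by the
    likelihood ratio of the observed cost, raised to the power [alpha t], and the
    geometric pooling averages the logarithms of the ratios with the weights [W].
    Two facts about this recursion give the theorem.

    The mean of the ratios over the agents converges almost surely. Conditionally
    on the past, the likelihood ratio of [k] to [ts] has mean one, since the cost
    has the density of [ts] ([likelihood_ratio_mean]). By convexity of the
    exponential, pooling replaces a ratio by at most the weighted mean of the
    ratios, and the power [alpha t] of a likelihood ratio [q] is at most
    [1 - alpha t + alpha t * q]. As the columns of [W] sum to one, the mean ratio is
    a nonnegative supermartingale ([mean_ratio_supermartingale]), and it converges
    by Doob's theorem ([supermartingale_cvg]), which is proved with upcrossings.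

    The log-ratios of any two agents merge. The likelihood ratios are bounded, so
    the log-ratios follow a linear consensus dynamics whose innovations are of
    order [alpha t], which tends to zero. The graph being connected and not
    bipartite, some power of [W] has positive entries
    ([weight_matrix_primitive]), and such a power contracts the largest gap
    between agents ([consensus]).

    Hence the ratio of every agent converges to the limit of the mean ratio
    ([belief_ratio_cvg]), and a belief is recovered by normalizing its ratios.

    The conditional statement is made precise by disintegration: the law of the
    pair formed by a cost and the past is determined on rectangles, so it has a
    density with respect to the product of Lebesgue measure and the law of the
    past ([integral_disintegration]). This requires the likelihood to be jointly
    measurable, which follows from its measurability in the cost and its
    continuity in the profile ([measurable_caratheodory]). *)

Set Implicit Arguments.
Unset Strict Implicit.
Unset Printing Implicit Defensive.

Local Open Scope classical_set_scope.
Local Open Scope ring_scope.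

(** * Primitivity of the weight matrix *)

Section Primitive.
Context {R : realType} {N : nat}.
Implicit Types (W : 'M[R]_N) (i j k : 'I_N) (m n : nat).

Lemma mxpow_ge0 W n i j : (forall i j, 0 <= W i j) -> 0 <= (W ^+ n) i j.
Proof.
move=> W_ge0; elim: n i j => [|n IH] i j; first by rewrite expr0 mxE ler0n.
by rewrite exprS mxE sumr_ge0// => k _; rewrite mulr_ge0.
Qed.

Lemma mxpow_row_sum W n i : (forall i, \sum_j W i j = 1) ->
  \sum_j (W ^+ n) i j = 1.
Proof.
move=> W1; elim: n i => [|n IH] i.
  rewrite expr0 (bigD1 i)//= mxE eqxx big1 ?addr0// => j /negPf ji.
  by rewrite mxE eq_sym ji.
rewrite exprS; under eq_bigr do rewrite mxE.
rewrite exchange_big/= -[RHS](W1 i); apply: eq_bigr => k _.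
by rewrite -mulr_sumr IH mulr1.
Qed.

Lemma mxpow_gt0D W m n i k j : (forall i j, 0 <= W i j) ->
  0 < (W ^+ m) i k -> 0 < (W ^+ n) k j -> 0 < (W ^+ (m + n)) i j.
Proof.
move=> W_ge0 ik kj; rewrite exprD mxE (bigD1 k)//= ltr_wpDr ?mulr_gt0//.
by apply: sumr_ge0 => l _; rewrite mulr_ge0// mxpow_ge0.
Qed.

End Primitive.

Section Walks.
Context {R : realType} {N : nat}.
Variables (E : rel 'I_N) (W : 'M[R]_N).
Hypotheses (E_sym : symmetric E) (W_weight : weight_matrix E W)
  (W_row : forall i, \sum_j W i j = 1) (E_connected : connected_graph E).

Let W_ge0 i j : 0 <= W i j. Proof. by case: W_weight. Qed.

Let W_edge i j : E i j -> 0 < (W ^+ 1) i j.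
Proof. by rewrite expr1 E_sym; case: W_weight => _ h /h. Qed.

Lemma walk_exists i j : exists m, 0 < (W ^+ m) i j.
Proof.
have /connectP[s] := E_connected i j.
elim: s i => [|k s IH] i /= => [_ -> | /andP[Eik sP] jE].
  by exists 0%N; rewrite expr0 mxE eqxx ltr01.
have [m mP] := IH k sP jE.
by exists (1 + m)%N; apply: mxpow_gt0D mP => //; exact: W_edge.
Qed.

Lemma backtrack_gt0 m i : 0 < (W ^+ m.*2) i i.
Proof.
elim: m => [|m IH]; first by rewrite expr0 mxE eqxx ltr01.
have [j Wij] : exists j, 0 < W i j.
  apply: contrapT => /forallNP h; have /eqP := W_row i.
  rewrite big1 1?eq_sym ?oner_eq0// => j _.
  by apply/eqP; rewrite eq_le W_ge0 leNgt andbT; apply/negP/h.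
have Eij : E i j by rewrite E_sym; case: W_weight => _ <-.
rewrite doubleS -addn2 addnC; apply: mxpow_gt0D IH => //.
apply: (@mxpow_gt0D _ _ _ 1 1 _ j) => //; apply: W_edge => //.
by rewrite E_sym.
Qed.

Hypothesis E_nonbip : ~ bipartite E.

(** Coloring each agent by the parity of the walks that lead to it from a fixed
    agent would be a bipartition if this parity were always determined. *)
Lemma even_walk_exists i j : exists m, ~~ odd m /\ 0 < (W ^+ m) i j.
Proof.
have [k [[m1 m1o m1P] [m2 m2e m2P]]] : exists k,
   (exists2 m, odd m & 0 < (W ^+ m) i k) /\
   (exists2 m, ~~ odd m & 0 < (W ^+ m) i k).
  apply: contrapT => /forallNP h; apply: E_nonbip.
  exists (fun k => `[< exists2 m, odd m & 0 < (W ^+ m) i k >]) => k l Ekl.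
  apply/negP => /eqP kl0; have kl := asbool_eq_equiv kl0.
  have [m mP] := walk_exists i k.
  have mSP : 0 < (W ^+ (m + 1)) i l.
    by apply: mxpow_gt0D mP _ => //; exact: W_edge.
  case: (boolP (odd m)) => mo.
    apply: (h l); split; last by exists (m + 1)%N => //; rewrite oddD mo.
    by apply/kl; exists m.
  apply: (h k); split; last by exists m.
  by apply/kl; exists (m + 1)%N => //; rewrite oddD (negPf mo).
have [q qP] := walk_exists k j.
case: (boolP (odd q)) => qo.
  by exists (m1 + q)%N; rewrite oddD m1o qo; split => //; exact: mxpow_gt0D m1P qP.
exists (m2 + q)%N; rewrite oddD (negPf m2e) qo; split => //.
exact: mxpow_gt0D m2P qP.
Qed.

(** Backtracking along an edge lengthens the even walks to a common length. *)
Lemma weight_matrix_primitive :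
  exists p, forall i j, 0 < (W ^+ p.+1) i j.
Proof.
have /choice[m mP] : forall ij : 'I_N * 'I_N, exists m,
    ~~ odd m /\ 0 < (W ^+ m) ij.1 ij.2 by move=> ij; exact: even_walk_exists.
(* [p.+1] is even and at least every [m ij] *)
exists (\sum_ij m ij).+1 => i j.
rewrite (bigD1 (i, j))//= -addn2 -addnA.
have [_ ijP] := mP (i, j).
set q := (_ + 2)%N.
have qe : ~~ odd q.
  rewrite /q oddD addbF; apply: (big_ind (fun s => ~~ odd s)) => // [a b|ij _].
    by rewrite oddD; case: (odd a); case: (odd b).
  by have [] := mP ij.
rewrite -(even_halfK qe); exact: mxpow_gt0D ijP (backtrack_gt0 _ _).
Qed.

End Walks.

(** * Consensus under vanishing innovations *)

(** Along each residue class modulo [p.+1] the sequence contracts geometrically, up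
    to an error that vanishes. *)
Lemma contraction_cvg0 {R : realType} (D e : nat -> R) (q : R) (p : nat) :
  0 <= q < 1 -> (forall t, 0 <= D t) ->
  (forall t, D (t + p.+1)%N <= q * D t + e t) ->
  e @ \oo --> (0 : R) -> D @ \oo --> (0 : R).
Proof.
move=> /andP[q0 q1] D0 De e0; apply/cvgrPdist_le => /= eps eps0.
have h0 : 0 < (1 - q) * (eps / 2) by rewrite mulr_gt0 ?subr_gt0// divr_gt0.
have /cvgrPdist_le/(_ _ h0)[t0 _ et0] := e0.
set C := \sum_(s < p.+1) D (t0 + s)%N.
have C0 : 0 <= C by exact: sumr_ge0.
have step m s : (s < p.+1)%N ->
    D (t0 + s + m * p.+1)%N <= q ^+ m * C + eps / 2.
  move=> sp; elim: m => [|m IH].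
    rewrite mul0n addn0 expr0 mul1r (@le_trans _ _ C)//.
      by rewrite /C (bigD1 (Ordinal sp))//= lerDl sumr_ge0.
    by rewrite lerDl divr_ge0// ltW.
  rewrite mulSnr addnA (le_trans (De _))//.
  have : `|0 - e (t0 + s + m * p.+1)%N| <= (1 - q) * (eps / 2).
    by apply: et0 => /=; rewrite -addnA leq_addr.
  rewrite sub0r normrN => /(le_trans (ler_norm _)) ele.
  rewrite (le_trans (lerD (ler_wpM2l q0 IH) ele))//.
  by rewrite exprS mulrDr mulrA -addrA -mulrDl [q + _]addrC subrK mul1r.
have qC : (fun m => q ^+ m * C) @ \oo --> (0 : R).
  rewrite -(mul0r C); apply: cvgM; last exact: cvg_cst.
  by apply: cvg_expr; rewrite ger0_norm.
have eps2 : 0 < eps / 2 by rewrite divr_gt0.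
have /cvgrPdist_le/(_ _ eps2)[m0 _ qm0] := qC.
exists (t0 + m0 * p.+1)%N => // t /= t0t.
rewrite sub0r normrN ger0_norm//.
have tt : t = (t0 + (t - t0) %% p.+1 + (t - t0) %/ p.+1 * p.+1)%N.
  rewrite -addnA [X in (_ + X)%N]addnC -divn_eq subnKC//.
  by rewrite (leq_trans _ t0t)// leq_addr.
rewrite tt (le_trans (step _ _ (ltn_pmod _ _)))//.
have : `|0 - q ^+ ((t - t0) %/ p.+1) * C| <= eps / 2.
  by apply: qm0 => /=; rewrite leq_divRL// leq_subRL ?(leq_trans _ t0t)// leq_addr.
rewrite sub0r normrN => /(le_trans (ler_norm _)) le1.
by rewrite (le_trans (lerD le1 (lexx _)))// -splitr.
Qed.

Section Spread.
Context {R : realType} {N : nat}.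
Implicit Types (A W : 'M[R]_N) (z : 'I_N -> R).

Definition spread z : R :=
  \big[Order.max/0]_(ij : 'I_N * 'I_N) `|z ij.1 - z ij.2|.

Lemma spread_ge0 z : 0 <= spread z.
Proof. exact: bigmax_ge_id. Qed.

Lemma le_spread z i j : `|z i - z j| <= spread z.
Proof. exact: (le_bigmax 0 (fun ij => `|z ij.1 - z ij.2|) (i, j)). Qed.

Lemma spread_le z D : 0 <= D -> (forall i j, `|z i - z j| <= D) -> spread z <= D.
Proof. by move=> D0 zD; apply: bigmax_le => // ij _; exact: zD. Qed.

(** Writing the difference of the averages of [z] by two rows of [A] as a double
    sum over pairs of agents, the diagonal pairs contribute nothing; they carry
    a mass of at least [c ^+ 2] when all entries of [A] are at least [c]. *)
Lemma spread_contraction A c z : 0 <= c -> (forall i j, c <= A i j) ->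
  (forall i, \sum_j A i j = 1) ->
  spread (fun i => \sum_j A i j * z j) <= (1 - c ^+ 2) * spread z.
Proof.
move=> c0 cA A1; have A0 i j : 0 <= A i j := le_trans c0 (cA i j).
have [[i0 _]|N0] := pselect (exists i : 'I_N, True); last first.
  suff z0 (u : 'I_N -> R) : spread u = 0 by rewrite !z0 mulr0.
  apply/eqP; rewrite eq_le spread_ge0 andbT.
  by apply: spread_le => // i; exfalso; apply: N0; exists i.
have c1 : 0 <= 1 - c ^+ 2.
  rewrite subr_ge0 exprn_ile1// (le_trans (cA i0 i0))//.
  by rewrite -(A1 i0) (bigD1 i0)//= lerDl sumr_ge0.
apply: spread_le => [|i j]; first by rewrite mulr_ge0 ?spread_ge0.
have -> : \sum_k A i k * z k - \sum_k A j k * z k =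
    \sum_k \sum_l A i k * A j l * (z k - z l).
  rewrite -[X in X - _]mulr1 -(A1 j) -[X in _ - X]mul1r -(A1 i).
  rewrite !mulr_suml -sumrB; apply: eq_bigr => k _.
  rewrite !mulr_sumr -sumrB; apply: eq_bigr => l _.
  by rewrite mulrBr mulrAC mulrA.
apply: (@le_trans _ _ (\sum_k \sum_(l | l != k) A i k * A j l * spread z)).
  rewrite (le_trans (ler_norm_sum _ _ _))//; apply: ler_sum => k _.
  rewrite (bigD1 k)//= subrr mulr0 add0r.
  rewrite (le_trans (ler_norm_sum _ _ _))//; apply: ler_sum => l _.
  by rewrite normrM ger0_norm ?mulr_ge0// ler_wpM2l ?mulr_ge0 ?le_spread.
under eq_bigr do rewrite -mulr_suml.
rewrite -mulr_suml ler_wpM2r ?spread_ge0//.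
have -> : \sum_k \sum_(l | l != k) A i k * A j l = 1 - \sum_k A i k * A j k.
  rewrite -[X in X - _](A1 i) -sumrB; apply: eq_bigr => k _.
  rewrite -mulr_sumr -[X in X - _]mulr1 -mulrBr -(A1 j).
  by rewrite [in RHS](bigD1 k)//= addrAC subrr add0r.
rewrite lerD2l lerN2 (bigD1 i0)//= ler_wpDr//.
  by apply: sumr_ge0 => k _; rewrite mulr_ge0.
by rewrite expr2 ler_pM.
Qed.

Lemma spread_add z e b : 0 <= b -> (forall i, `|e i| <= b) ->
  spread (fun i => z i + e i) <= spread z + 2 * b.
Proof.
move=> b0 eb; apply: spread_le => [|i j].
  by rewrite addr_ge0 ?spread_ge0 ?mulr_ge0.
have -> : z i + e i - (z j + e j) = (z i - z j) + (e i - e j).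
  by rewrite opprD addrACA.
rewrite (le_trans (ler_normD _ _))// lerD ?le_spread//.
by rewrite (le_trans (ler_normB _ _))// mulr_natl mulr2n lerD.
Qed.

Lemma average_le A e b i : (forall i j, 0 <= A i j) ->
  (forall i, \sum_j A i j = 1) -> (forall j, `|e j| <= b) ->
  `|\sum_j A i j * e j| <= b.
Proof.
move=> A0 A1 eb; rewrite (le_trans (ler_norm_sum _ _ _))//.
rewrite -[leRHS]mul1r -(A1 i) mulr_suml; apply: ler_sum => j _.
by rewrite normrM ger0_norm// ler_wpM2l.
Qed.

(** Averaging with a primitive stochastic matrix makes the agents agree, even
    when each step adds an innovation, provided the innovations vanish. *)
Lemma consensus W p (z e : nat -> 'I_N -> R) (b : nat -> R) :
  (forall i j, 0 <= W i j) -> (forall i, \sum_j W i j = 1) ->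
  (forall i j, 0 < (W ^+ p.+1) i j) ->
  (forall t i, z t.+1 i = \sum_j W i j * (z t j + e t j)) ->
  nonincreasing_seq b -> b @ \oo --> (0 : R) ->
  (forall t i, `|e t i| <= b t) ->
  forall i j, (fun t => z t i - z t j) @ \oo --> (0 : R).
Proof.
move=> W0 W1 Wp zS bdec b0 eb i0 j0.
have b_ge0 t : 0 <= b t by exact: le_trans (eb t i0).
have unroll m t : exists2 e' : 'I_N -> R, (forall i, `|e' i| <= m%:R * b t) &
    forall i, z (t + m)%N i = \sum_j (W ^+ m) i j * z t j + e' i.
  elim: m => [|m [e' e'b zm]].
    exists (fun=> 0) => i; first by rewrite normr0 mul0r.
    rewrite addr0 addn0 expr0 (bigD1 i)//= mxE eqxx mul1r big1 ?addr0// => j ji.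
    by rewrite mxE eq_sym (negPf ji) mul0r.
  exists (fun i => \sum_j W i j * (e' j + e (t + m)%N j)) => i.
    apply: average_le => // j; rewrite (le_trans (ler_normD _ _))//.
    rewrite -natr1 mulrDl mul1r lerD// (le_trans (eb _ _))//.
    by apply: bdec; rewrite leq_addr.
  rewrite addnS zS; under eq_bigr do rewrite zm -addrA mulrDr.
  rewrite big_split/=; congr +%R; under eq_bigr do rewrite mulr_sumr.
  rewrite exchange_big/=; apply: eq_bigr => k _.
  by rewrite exprS mxE mulr_suml; apply: eq_bigr => l _; rewrite mulrA.
have [c c0 cW] : exists2 c, 0 < c & forall i j, c <= (W ^+ p.+1) i j.
  exists (\big[Order.min/1]_(ij : 'I_N * 'I_N) (W ^+ p.+1) ij.1 ij.2).
    by apply: lt_bigmin.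
  by move=> i j; exact: (bigmin_le 1 (i, j) (fun ij => (W ^+ p.+1) ij.1 ij.2)).
have c1 : c <= 1.
  rewrite (le_trans (cW i0 i0))// -(mxpow_row_sum p.+1 i0 W1) (bigD1 i0)//=.
  by rewrite lerDl sumr_ge0// => j _; exact/ltW.
have spread0 : (fun t => spread (z t)) @ \oo --> (0 : R).
  apply: (@contraction_cvg0 _ _ (fun t => 2 * (p.+1%:R * b t)) (1 - c ^+ 2) p).
  - by rewrite subr_ge0 exprn_ile1 ?(ltW c0)//= ltrBlDr ltrDl exprn_gt0.
  - by move=> t; exact: spread_ge0.
  - move=> t; have [e' e'b zp] := unroll p.+1 t.
    have -> : z (t + p.+1)%N =
        (fun i => \sum_j (W ^+ p.+1) i j * z t j + e' i) by apply/funext.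
    rewrite (le_trans (spread_add _ _ e'b)) ?mulr_ge0// lerD2r.
    apply: spread_contraction => //; first exact: ltW.
    by move=> i; exact: mxpow_row_sum.
  - rewrite -[X in _ --> X](mulr0 2) -[X in 2 * X](mulr0 p.+1%:R).
    exact: cvgM (cvg_cst _) (cvgM (cvg_cst _) b0).
apply/norm_cvg0P; apply: squeeze_cvgr (cvg_cst 0) spread0.
by apply: nearW => t; rewrite normr_ge0/= le_spread.
Qed.

End Spread.

(** * Convergence of nonnegative supermartingales *)

Section Upcrossings.
Context {R : realType}.
Implicit Types (u : nat -> R) (a b : R) (t n : nat).

(** The strategy that buys when the price is at most [a] and sells when it is at
    least [b]: [holding u a b t] tells whether the stock is held between the
    times [t] and [t.+1], and [upcrossings u a b t] counts the sales. *)
Fixpoint holding u a b t : bool :=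
  if t is t'.+1 then
    if holding u a b t' then u t < b else u t <= a
  else u t <= a.

Fixpoint upcrossings u a b t : nat :=
  if t is t'.+1 then
    (upcrossings u a b t' + (holding u a b t' && (b <= u t)%R))%N
  else 0%N.

Lemma upcrossings_mono u a b m n : (m <= n)%N ->
  (upcrossings u a b m <= upcrossings u a b n)%N.
Proof.
elim: n => [|n IH]; first by rewrite leqn0 => /eqP ->.
by rewrite leq_eqVlt => /predU1P[->//|/IH /leq_trans]; apply; exact: leq_addr.
Qed.

(** Each sale earns at least [b - a], and what is held at the end has lost at
    most [a]. *)
Lemma upcrossings_gain u a b n : 0 <= a -> (forall t, 0 <= u t) ->
  (b - a) * (upcrossings u a b n)%:R
    + \sum_(t < n) (holding u a b t)%:R * u t
  <= a + \sum_(t < n) (holding u a b t)%:R * u t.+1.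
Proof.
move=> a0 u0.
suff : (b - a) * (upcrossings u a b n)%:R
    + \sum_(t < n) (holding u a b t)%:R * u t
    + (holding u a b n)%:R * (u n - a)
  <= \sum_(t < n) (holding u a b t)%:R * u t.+1.
  have := u0 n.
  by case: (holding u a b n); rewrite ?mul1r ?mul0r /=; lra.
elim: n => [|n IH].
  rewrite !big_ord0 mulr0 !add0r /=.
  by case: (leP (u 0%N) a) => h; rewrite ?mul0r ?mul1r ?subr_le0.
rewrite !big_ord_recr/=.
set S := \sum_(t < n) _ in IH *; set S' := \sum_(t < n) _ in IH *.
case: (holding u a b n) IH => /=; rewrite ?mul1r ?mul0r ?addn0 ?addr0 => IH.
  case: (leP b (u n.+1)) => h /=.
    by rewrite addn1 -natr1 mul0r; move: IH h; lra.
  by rewrite addn0 mul1r; move: IH h; lra.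
by case: (leP (u n.+1) a) => h /=; rewrite ?mul1r ?mul0r; move: IH h; lra.
Qed.

Lemma holding_le u a b t : a < b -> u t <= a -> holding u a b t.
Proof.
move=> ab; case: t => [|t]//= uta.
by case: holding => //; exact: le_lt_trans uta ab.
Qed.

Lemma holding_upcrossing u a b n k : holding u a b n -> b <= u (n + k).+1 ->
  (upcrossings u a b n < upcrossings u a b (n + k).+1)%N.
Proof.
elim: k n => [|k IH] n hn; first by rewrite addn0 /= hn => ->; rewrite addn1.
rewrite addnS -addSn => bu; case: (leP b (u n.+1)) => h.
  apply: (@leq_trans (upcrossings u a b n.+1)); first by rewrite /= hn h addn1.
  by apply: upcrossings_mono; rewrite ltnS ltnW// ltnS leq_addr.
apply: leq_ltn_trans (IH _ _ bu); last by rewrite /= hn.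
by rewrite /= leq_addr.
Qed.

Definition infinitely_often (A : set nat) := forall n, exists2 m, (n <= m)%N & A m.

Lemma infinite_upcrossings u a b : a < b ->
  infinitely_often [set t | u t <= a] -> infinitely_often [set t | b <= u t] ->
  forall K, exists n, (K <= upcrossings u a b n)%N.
Proof.
move=> ab ua ub; elim=> [|K [n Kn]]; first by exists 0%N.
have [m nm uma] := ua n; have [l ml bul] := ub m.+1.
have lE : l = (m + (l - m.+1)).+1 by rewrite -addSn subnKC.
exists l; rewrite (leq_ltn_trans (leq_trans Kn (upcrossings_mono u a b nm)))//.
by rewrite lE holding_upcrossing ?holding_le// -lE.
Qed.

(** The limit is the infimum of the levels below which the sequence returns
    infinitely often: staying infinitely often above a larger level would produce
    infinitely many upcrossings of some rational interval. *)
Lemma cvgn_upcrossings u K : (forall t, 0 <= u t) ->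
  infinitely_often [set t | u t <= K] ->
  (forall p q : rat, 0 <= ratr p :> R -> ratr p < ratr q :> R ->
    exists B, forall n, (upcrossings u (ratr p) (ratr q) n <= B)%N) ->
  cvgn u.
Proof.
move=> u0 uK bounded.
pose S := [set a | infinitely_often [set t | u t <= a]].
have S0 a : S a -> 0 <= a by move=> /(_ 0%N)[m _]; exact: le_trans (u0 m).
have infS : has_inf S by split; [exists K|exists 0 => a /S0].
apply/cvg_ex; exists (inf S); apply/cvgrPdist_lt => /= e e0.
have [a Sa ae] := inf_adherent e0 infS.
have [p] := rat_in_itvoo ae; rewrite in_itv/= => /andP[ap pe].
have [q] := rat_in_itvoo pe; rewrite in_itv/= => /andP[pq qe].
have [n1 n1P] : exists n1, forall n, (n1 <= n)%N -> u n < ratr q.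
  apply: contrapT => /forallNP h.
  have p0 : 0 <= ratr p :> R by rewrite (le_trans (S0 _ Sa))// ltW.
  have [B Bn] := bounded p q p0 pq.
  have ioa : infinitely_often [set t | u t <= ratr p].
    move=> n; have [m nm ma] := Sa n.
    by exists m => //=; exact: le_trans ma (ltW ap).
  have iob : infinitely_often [set t | ratr q <= u t].
    move=> n; have /existsNP[m /not_implyP[nm /negP]] := h n.
    by rewrite -leNgt => qm; exists m.
  have [n] := infinite_upcrossings pq ioa iob B.+1.
  by apply/negP; rewrite -leqNgt.
have [n2 n2P] : exists n2, forall n, (n2 <= n)%N -> inf S - e < u n.
  apply: contrapT => /forallNP h.
  have : S (inf S - e).
    move=> n; have /existsNP[m /not_implyP[nm /negP]] := h n.
    by rewrite -leNgt => qm; exists m.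
  move=> /(ge_inf infS.2); apply/negP; rewrite -ltNge.
  by rewrite ltrBlDr ltrDl.
exists (maxn n1 n2) => // n /=; rewrite geq_max => /andP[nn1 nn2].
by rewrite distrC ltr_distlC; have := n1P _ nn1; have := n2P _ nn2; lra.
Qed.

End Upcrossings.

Lemma coarser_measurable_fun d (T : measurableType d) (G : set (set T)) d'
    (T' : measurableType d') (h : T -> T') : <<s G >> `<=` measurable ->
  measurable_fun setT (h : g_sigma_algebraType G -> T') -> measurable_fun setT h.
Proof. by move=> mG mh _ Y mY; apply: mG; exact: mh. Qed.

Section Supermartingale.
Context {R : realType} {d : measure_display} {Omega : measurableType d}.
Variable P : probability Omega R.

Lemma measurable_nat_of_bool d' (T : measurableType d') (h : T -> bool) :
  measurable_fun setT h -> measurable_fun setT (fun w => (h w)%:R : R).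
Proof.
move=> mh; apply: (measurableT_comp (f := fun c : bool => c%:R : R)) => //.
Qed.

(** By Fatou's lemma the lower limit has a finite integral. *)
Lemma infinitely_often_bounded_ae (f : nat -> Omega -> R) (C : R) :
  (forall n, measurable_fun setT (f n)) -> (forall n w, 0 <= f n w) ->
  (forall n, \int[P]_w (f n w)%:E <= C%:E)%E ->
  {ae P, forall w, exists K, infinitely_often [set n | f n w <= K]}.
Proof.
move=> mf f0 fC; pose g w := limn_einf (fun n => (f n w)%:E).
have mg : measurable_fun setT g.
  apply: measurableT_comp => //; apply: measurable_fun_limn_esup => n.
  by apply: measurableT_comp => //; exact/measurable_EFinP.
have g0 w : (0 <= g w)%E.
  rewrite /g limn_einf_lim; apply: lime_ge; first exact: is_cvg_einfs.
  by apply: nearW => n; apply/ereal_infP => _ [m _ <-]; rewrite lee_fin.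
have : P.-integrable setT g.
  apply/integrableP; split => //; apply: (@le_lt_trans _ _ C%:E); last exact: ltry.
  under eq_integral do rewrite gee0_abs//.
  apply: (le_trans (fatou P measurableT _ _)).
  - by move=> n; exact/measurable_EFinP.
  - by move=> n w _; rewrite lee_fin.
  rewrite limn_einf_lim; apply: lime_le; first exact: is_cvg_einfs.
  apply: nearW => n; apply: le_trans (fC n).
  by apply: ereal_inf_lbound; exists n => /=.
move=> /(integrable_ae measurableT); apply: filterS => w /(_ I) gw.
apply: contrapT => /forallNP h.
have : (f n w)%:E @[n --> \oo] --> +oo%E.
  apply/cvgeyPge => K; have /existsNP[n nP] := h K.
  exists n => // m /= nm; rewrite lee_fin leNgt; apply/negP => mK.
  by apply: nP; exists m => //=; exact: ltW.
by move=> /cvg_limn_einf_sup[gE _]; move: gw; rewrite /g gE.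
Qed.

Variables (G : nat -> set (set Omega)) (M : nat -> Omega -> R).
Hypotheses (G_measurable : forall t, <<s G t>> `<=` measurable)
  (G_mono : forall t, <<s G t>> `<=` <<s G t.+1>>)
  (M_ge0 : forall t w, 0 <= M t w)
  (M_adapted : forall t,
    measurable_fun setT (M t : g_sigma_algebraType (G t) -> R))
  (M_super : forall t (A : set Omega), <<s G t>> A ->
    (\int[P]_(w in A) (M t.+1 w)%:E <= \int[P]_(w in A) (M t w)%:E)%E)
  (M0_lty : (\int[P]_w (M 0 w)%:E < +oo)%E).

Let mM t : measurable_fun setT (M t).
Proof. exact: (coarser_measurable_fun (@G_measurable t) (@M_adapted t)). Qed.

Let mEM t : measurable_fun setT (fun w => (M t w)%:E).
Proof. exact/measurable_EFinP. Qed.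

Let EM t : (\int[P]_w (M t w)%:E <= \int[P]_w (M 0 w)%:E)%E.
Proof.
elim: t => // t; apply: le_trans; apply: M_super.
exact: (@measurableT _ (g_sigma_algebraType (G t))).
Qed.

Let measurable_holding a b t : measurable_fun setT
  ((fun w => holding (M ^~ w) a b t) : g_sigma_algebraType (G t) -> bool).
Proof.
elim: t => [|t IH] /=; first exact: measurable_fun_ler.
apply: measurable_fun_ifT; last 2 first.
- exact: measurable_fun_ltr.
- exact: measurable_fun_ler.
- by move=> _ Y mY; apply: G_mono; exact: IH.
Qed.

Let measurable_upcrossings a b t :
  measurable_fun setT (fun w => (upcrossings (M ^~ w) a b t)%:R : R).
Proof.
elim: t => [|t IH] /=; first exact: measurable_cst.
under eq_fun do rewrite natrD.
apply: measurable_funD => //; apply: measurable_nat_of_bool.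
apply: measurable_and; last exact: measurable_fun_ler.
exact: (coarser_measurable_fun (@G_measurable t) (@measurable_holding a b t)).
Qed.

(** Trading a supermartingale on the basis of the past earns nothing on average,
    so the gain guaranteed by [upcrossings_gain] bounds the number of sales. *)
Lemma upcrossing_inequality a b n : 0 <= a -> a < b ->
  (\int[P]_w (upcrossings (M ^~ w) a b n)%:R%:E <= (a / (b - a))%:E)%E.
Proof.
move=> a0 ab; have ba : 0 < b - a by rewrite subr_gt0.
pose H t w : R := (holding (M ^~ w) a b t)%:R.
have mH t : measurable_fun setT (H t).
  apply: measurable_nat_of_bool.
  exact: (coarser_measurable_fun (@G_measurable t) (@measurable_holding a b t)).
have mHM t s : measurable_fun setT (fun w => (H t w * M s w)%:E).
  by apply/measurable_EFinP; exact: measurable_funM.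
have HM0 t s w : (0 <= (H t w * M s w)%:E)%E by rewrite lee_fin mulr_ge0.
have HMS t : (\int[P]_w (H t w * M t.+1 w)%:E <= \int[P]_w (H t w * M t w)%:E)%E.
  have HE s : (\int[P]_w (H t w * M s w)%:E =
      \int[P]_(w in [set w | holding (M ^~ w) a b t]) (M s w)%:E)%E.
    rewrite [RHS]integral_mkcond; apply: eq_integral => w _.
    rewrite /H patchE; case: ifPn; rewrite ?inE/= => h.
      by rewrite h mul1r.
    by move: h; rewrite notin_setE => /negP/negPf ->; rewrite mul0r.
  rewrite !HE; apply: M_super.
  have mh := @measurable_holding a b t.
  have := mh (@measurableT _ (g_sigma_algebraType (G t))) [set true] I.
  by rewrite setTI.
have HMlty t : (\int[P]_w (H t w * M t w)%:E < +oo)%E.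
  apply: le_lt_trans (le_lt_trans (EM t) M0_lty).
  apply: ge0_le_integral => // w _.
  by rewrite lee_fin /H; case: holding; rewrite ?mul1r ?mul0r.
have : (\int[P]_w ((b - a) * (upcrossings (M ^~ w) a b n)%:R
          + \sum_(t < n) H t w * M t w)%:E
     <= \int[P]_w (a + \sum_(t < n) H t w * M t.+1 w)%:E)%E.
  apply: ge0_le_integral => //.
  - move=> w _; rewrite lee_fin addr_ge0 ?mulr_ge0 ?(ltW ba)//.
    by apply: sumr_ge0 => t _; rewrite -lee_fin HM0.
  - apply/measurable_EFinP/measurable_funD; first exact: measurable_funM.
    by apply: measurable_sum => t; exact: measurable_funM.
  - apply/measurable_EFinP/measurable_funD => //.
    by apply: measurable_sum => t; exact: measurable_funM.
  - by move=> w _; rewrite lee_fin; exact: upcrossings_gain.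
have mU : measurable_fun setT (fun w => (upcrossings (M ^~ w) a b n)%:R%:E : \bar R).
  exact/measurable_EFinP.
have sum0 s (D : set Omega) w : D w -> (0 <= \sum_(t < n) (H t w * M (s t) w)%:E)%E.
  by move=> _; exact: sume_ge0.
have msum s : measurable_fun setT (fun w => \sum_(t < n) (H t w * M (s t) w)%:E)%E.
  exact: emeasurable_sum.
rewrite (_ : (\int[P]_w ((b - a) * (upcrossings (M ^~ w) a b n)%:R
          + \sum_(t < n) H t w * M t w)%:E =
    (b - a)%:E * \int[P]_w (upcrossings (M ^~ w) a b n)%:R%:E
      + \sum_(t < n) \int[P]_w (H t w * M t w)%:E)%E); last first.
  under [LHS]eq_integral do rewrite EFinD -sumEFin EFinM.
  rewrite ge0_integralD//; last 3 first.
  - by move=> w _; rewrite mule_ge0// lee_fin ltW.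
  - exact: measurable_funeM.
  - exact: (sum0 id).
  rewrite ge0_integral_sum// ge0_integralZl_EFin//; last exact: ltW.
rewrite (_ : (\int[P]_w (a + \sum_(t < n) H t w * M t.+1 w)%:E =
    a%:E + \sum_(t < n) \int[P]_w (H t w * M t.+1 w)%:E)%E); last first.
  under [LHS]eq_integral do rewrite EFinD -sumEFin.
  rewrite ge0_integralD//; last first.
    exact: sum0.
  by rewrite integral_cst//= probability_setT mule1 ge0_integral_sum.
have Sfin : \sum_(t < n) (\int[P]_w (H t w * M t w)%:E)%E \is a fin_num.
  apply/sum_fin_numP => t _ _; rewrite ge0_fin_numE// integral_ge0//.
move=> /le_trans h.
have /h : (a%:E + \sum_(t < n) \int[P]_w (H t w * M t.+1 w)%:E <=
    a%:E + \sum_(t < n) \int[P]_w (H t w * M t w)%:E)%E.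
  by rewrite leeD2l//; apply: lee_sum => t _; exact: HMS.
by rewrite leeD2rE// EFinM lee_pdivlMr// muleC.
Qed.

(** Almost surely every rational interval is crossed finitely many times, and the
    lower limit is finite. *)
Theorem supermartingale_cvg : {ae P, forall w, cvgn (M ^~ w)}.
Proof.
pose bounded p q w := exists K, infinitely_often
  [set n | (upcrossings (M ^~ w) (ratr p) (ratr q) n)%:R <= K :> R].
have up (n : nat) : {ae P, forall w, forall pq : rat * rat,
    unpickle n = Some pq -> 0 <= ratr pq.1 :> R -> ratr pq.1 < ratr pq.2 :> R ->
    bounded pq.1 pq.2 w}.
  case: (unpickle n) => [[p q]|]; last exact: aeW.
  have [p0|p0] := boolP (0 <= ratr p :> R); last first.
    by apply: aeW => w _ [<-]; rewrite (negPf p0).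
  have [pq|pq] := boolP (ratr p < ratr q :> R); last first.
    by apply: aeW => w _ [<-]; rewrite (negPf pq).
  have : {ae P, forall w, bounded p q w}.
    apply: (@infinitely_often_bounded_ae
      (fun n w => (upcrossings (M ^~ w) (ratr p) (ratr q) n)%:R)) => // m.
    exact: upcrossing_inequality.
  by apply: filterS => w bw pq' [<-].
have low := @infinitely_often_bounded_ae M (fine (\int[P]_w (M 0 w)%:E)).
have {}low : {ae P, forall w, exists K, infinitely_often [set n | M n w <= K]}.
  apply: low => // n; rewrite fineK ?EM// ge0_fin_numE// integral_ge0// => w _.
  by rewrite lee_fin.
apply: filterS2 (ae_foralln up) low => w upw [K lowK].
apply: cvgn_upcrossings lowK _ => // p q p0 pq.
have [C Cw] := upw (pickle (p, q)) _ (pickleK _) p0 pq.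
exists (Num.truncn C) => n; have [m nm mC] := Cw n.
rewrite (leq_trans (upcrossings_mono _ _ _ nm))//.
by rewrite truncn_ge_nat// (le_trans _ mC).
Qed.

End Supermartingale.

(** * Measurability in the profile and the observation *)

Section ProfileTopology.
Context {R : realType} {N : nat} {n : 'I_N -> nat}.

Lemma cvg_profile (z : nat -> profile R n) (l : profile R n) (e : nat -> R) :
  e @ \oo --> (0 : R) ->
  (forall m i k, `|l i 0 k - z m i 0 k| < e m) ->
  z @ \oo --> l.
Proof.
move=> e0 ze; apply/cvg_sup => i A /= [_ [[B Bop <-] Bl] sBA].
suff zl : (fun m => z m i) @ \oo --> l i.
  have /zl : nbhs (l i) B by apply: open_nbhs_nbhs.
  by apply: (@filterS _ \oo) => m zB; apply: sBA.
apply/(@cvg_ballP R 'rV[R]_(n i)) => eps eps0.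
have /cvgr0Pnorm_lt/(_ eps eps0) := e0; apply: filterS => m em.
split=> // i' k; rewrite (ord1 i'); apply: lt_trans (ze _ _ _) _.
by apply: le_lt_trans em; exact: ler_norm.
Qed.

End ProfileTopology.

Section Caratheodory.
Context {R : realType} {N : nat} {n : 'I_N -> nat}.
Variables (A : set (profile R n)) (g : R -> profile R n -> R).
Hypotheses (mg : forall z, A z -> measurable_fun setT (g ^~ z))
  (g_cont : forall v, {within A, continuous (g v)}).
Context {d : measure_display} {S : measurableType d}.
Variables (Y : S -> R) (Z : S -> profile R n).
Hypotheses (mY : measurable_fun setT Y)
  (mZ : forall i k, measurable_fun setT (fun s => Z s i 0 k))
  (AZ : forall s, A (Z s)).

Let cell m s : {ffun {i : 'I_N & 'I_(n i)} -> int} :=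
  [ffun p => Num.floor (m.+1%:R * Z s (tag p) 0 (tagged p))].

Let rep m c : profile R n := Z (xget point [set s | cell m s = c]).

Let rep_cell m s : exists2 s', cell m s' = cell m s & rep m (cell m s) = Z s'.
Proof.
by rewrite /rep; case: xgetP => [s' _ s's|/(_ s) []//]; exists s'.
Qed.

Let measurable_cell m c : measurable [set s | cell m s = c].
Proof.
rewrite (_ : [set s | _] = \bigcap_(p in setT) [set s |
    (c p)%:~R <= m.+1%:R * Z s (tag p) 0 (tagged p) < (c p + 1)%:~R]); last first.
  apply/seteqP; split=> [s sc p _|s sc] /=.
    by rewrite -floor_eq -sc ffunE.
  by apply/ffunP => p; rewrite ffunE; apply/eqP; rewrite floor_eq; exact: sc.
apply: fin_bigcap_measurable => [|p _]; first exact: finite_finset.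
have mz : measurable_fun setT (fun s => m.+1%:R * Z s (tag p) 0 (tagged p)).
  exact: measurable_funM.
have mb : measurable_fun setT (fun s =>
    ((c p)%:~R <= m.+1%:R * Z s (tag p) 0 (tagged p) < (c p + 1)%:~R)).
  apply: measurable_and; first exact: measurable_fun_ler.
  exact: measurable_fun_ltr.
by have := mb measurableT [set true] I; rewrite setTI.
Qed.

Let cvg_rep s : (fun m => rep m (cell m s)) @ \oo --> Z s.
Proof.
apply: (@cvg_profile _ _ _ _ _ (fun m => m.+1%:R^-1)); first exact: cvg_harmonic.
move=> m i k; have [s' cs ->] := rep_cell m s.
have := congr1 (fun c : {ffun _ -> _} => c (Tagged (fun i => 'I_(n i)) k)) cs.
rewrite !ffunE/= => fl.
have := floor_itv (m.+1%:R * Z s' i 0 k); rewrite fl => /andP[s1 s2].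
have /andP[s3 s4] := floor_itv (m.+1%:R * Z s i 0 k).
rewrite -(ltr_pM2l (_ : 0 < m.+1%:R)) ?ltr0n// mulfV ?pnatr_eq0//.
rewrite -[X in X * _](ger0_norm (ler0n R m.+1)) -normrM mulrBr.
rewrite intrD in s2 s4; rewrite ltr_distl; apply/andP; split.
  by rewrite ltrBlDr (lt_le_trans s2)// lerD2r.
by rewrite (lt_le_trans s4)// lerD2r.
Qed.

(** A function that is measurable in the observation and continuous in the
    profile is measurable in both: on a grid of mesh [m.+1%:R^-1] the profile is
    replaced by one of its values in the same cell, and there are only countably
    many cells. *)
Lemma measurable_caratheodory : measurable_fun setT (fun s => g (Y s) (Z s)).
Proof.
apply: (@measurable_fun_cvg _ _ _ _ (fun m s => g (Y s) (rep m (cell m s)))).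
  move=> m _ B mB; rewrite setTI.
  rewrite (_ : _ @^-1` B = \bigcup_c ([set s | cell m s = c] `&`
      [set s | B (g (Y s) (rep m c))])); last first.
    apply/seteqP; split=> [s Bs|s [c _ [/= <-]]//].
    by exists (cell m s).
  apply: countable_bigcupT_measurable; first exact: countableP.
  move=> c.
  apply: measurableI => //.
  have Ac : A (rep m c) by rewrite /rep; exact: AZ.
  have := measurableT_comp (mg Ac) mY.
  by move=> /(_ measurableT _ mB); rewrite setTI.
move=> s _.
have /(_ _ (AZ s)) gs := (subspace_continuousP A (g (Y s))).1 (@g_cont (Y s)).
apply: cvg_comp gs => D /cvg_rep; apply: (@filterS _ \oo) => m; apply.
exact: AZ.
Qed.

End Caratheodory.

(** * Disintegration of a joint law *)

Section Density.
Local Open Scope ereal_scope.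
Context {d : measure_display} {T : measurableType d} {R : realType}.
Variables (m Q : {measure set T -> \bar R}) (phi : T -> R).
Hypotheses (mphi : measurable_fun setT phi) (phi_ge0 : forall z, (0 <= phi z)%R)
  (density : forall C, measurable C -> Q C = \int[m]_(z in C) (phi z)%:E).

Import HBNNSimple.

Let integral_density_nnsfun (h : {nnsfun T >-> R}) :
  \int[Q]_z (h z)%:E = \int[m]_z (h z * phi z)%:E.
Proof.
rewrite integralT_nnsfun sintegralE.
transitivity (\int[m]_z \sum_(r \in range h)
    (r%:E * (\1_(h @^-1` [set r]) z * phi z)%:E)); last first.
  apply: eq_integral => z _; rewrite [in RHS]fimfunE mulr_fsuml//.
  by rewrite -fsumEFin//; apply: eq_fsbigr => r _; rewrite -EFinM mulrA.
rewrite ge0_integral_fsum//; last 2 first.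
- move=> r; apply: measurable_funeM; apply/measurable_EFinP.
  exact: measurable_funM.
- move=> r z _; have [r0|r0] := leP 0%R r.
    by rewrite mule_ge0// lee_fin mulr_ge0.
  by rewrite preimage_nnfun0// indic0 mul0r mule0.
apply: eq_fsbigr => r; rewrite inE => -[z _ <-].
rewrite ge0_integralZl_EFin//; last 2 first.
- by move=> z' _; rewrite lee_fin mulr_ge0.
- by apply/measurable_EFinP; exact: measurable_funM.
congr (_ * _); rewrite density// integral_mkcond; apply: eq_integral => z' _.
by rewrite patchE indicE; case: ifP; rewrite ?mul1r ?mul0r.
Qed.

Lemma integral_density (h : T -> R) :
  measurable_fun setT h -> (forall z, 0 <= h z)%R ->
  \int[Q]_z (h z)%:E = \int[m]_z (h z * phi z)%:E.
Proof.
move=> mh h0; have mEh : measurable_fun setT (EFin \o h) by exact/measurable_EFinP.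
pose f := nnsfun_approx measurableT mEh.
have f_h z : (f k z)%:E @[k --> \oo] --> (h z)%:E.
  by apply: cvg_nnsfun_approx => // x _; rewrite lee_fin.
have nd_f z : {homo (fun k => f k z) : k l / (k <= l)%N >-> (k <= l)%R}.
  by move=> k l kl; exact/lefP/nd_nnsfun_approx.
transitivity (limn (fun k => \int[Q]_z (f k z)%:E)).
  rewrite -monotone_convergence//.
  - by apply: eq_integral => z _; apply/esym/cvg_lim => //; exact: f_h.
  - by move=> k; exact/measurable_EFinP.
  - by move=> k z _; rewrite lee_fin.
  - by move=> z _ k l kl; rewrite lee_fin nd_f.
under eq_fun do rewrite integral_density_nnsfun.
rewrite -monotone_convergence//.
- apply: eq_integral => z _; apply/cvg_lim => //.
  under eq_fun do rewrite EFinM.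
  by rewrite EFinM; apply: cvgeZr => //; exact: f_h.
- by move=> k; apply/measurable_EFinP; exact: measurable_funM.
- by move=> k z _; rewrite lee_fin mulr_ge0.
- by move=> z _ k l kl; rewrite lee_fin ler_wpM2r// nd_f.
Qed.

End Density.

Section Disintegration.
Local Open Scope ereal_scope.
Context {d1 d2 : measure_display} {T1 : measurableType d1}
  {T2 : measurableType d2} {R : realType}.
Variables (m1 : {sigma_finite_measure set T1 -> \bar R})
  (m2 : {sigma_finite_measure set T2 -> \bar R})
  (Q : {finite_measure set (T1 * T2)%type -> \bar R}) (phi : (T1 * T2)%type -> R).
Hypotheses (mphi : measurable_fun setT phi) (phi_ge0 : forall z, (0 <= phi z)%R)
  (Q_rect : forall B A, measurable B -> measurable A ->
    Q (B `*` A) = \int[m2]_(w in A) \int[m1]_(v in B) (phi (v, w))%:E).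

Let integral_rect B A : measurable B -> measurable A ->
  \int[m1 \x m2]_(z in B `*` A) (phi z)%:E
    = \int[m2]_(w in A) \int[m1]_(v in B) (phi (v, w))%:E.
Proof.
move=> mB mA; rewrite [LHS]integral_mkcond fubini_tonelli2; last 2 first.
- apply/(measurable_restrictT _ _).1; first exact: measurableX.
  by apply: measurable_funTS; exact/measurable_EFinP.
- by move=> z; rewrite patchE; case: ifP => _; rewrite ?lee_fin.
rewrite [RHS]integral_mkcond; apply: eq_integral => w _.
rewrite /fubini_G patchE; case: ifPn => [|/negP]; rewrite inE => Aw.
  rewrite [RHS]integral_mkcond; apply: eq_integral => v _.
  by rewrite !patchE in_setX (mem_set Aw) andbT.
apply: integral0_eq => v _; rewrite patchE ifF//.
by apply/negbTE/negP; rewrite inE => -[].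
Qed.

Let density C : measurable C -> Q C = \int[m1 \x m2]_(z in C) (phi z)%:E.
Proof.
pose nu C := \int[m1 \x m2]_(z in C) (phi z)%:E.
have nu0 : nu set0 = 0 by exact: integral_set0.
have nu_ge0 C' : 0 <= nu C'.
  by apply: integral_ge0 => z _; rewrite lee_fin.
have nu_sigma : semi_sigma_additive nu.
  apply: semi_sigma_additive_nng_induced; first exact/measurable_EFinP.
  by move=> z; rewrite lee_fin.
pose nuM := isMeasure.Build _ _ _ nu nu0 nu_ge0 nu_sigma.
pose nu' : {measure set (T1 * T2)%type -> \bar R} := HB.pack nu nuM.
apply: (@measure_unique _ _ _
  [set B `*` A | B in measurable & A in measurable] (fun=> setT) _ _ _ _ Q nu').
- exact: measurable_prod_measurableType.
- move=> _ _ [B1 mB1 [A1 mA1 <-]] [B2 mB2 [A2 mA2 <-]]; rewrite -setXI.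
  by exists (B1 `&` B2); [exact: measurableI|]; exists (A1 `&` A2) => //;
     exact: measurableI.
- by move=> _; exists setT => //; exists setT => //; rewrite setXTT.
- by rewrite bigcup_const.
- by move=> _ [B mB [A mA <-]]; rewrite [LHS]Q_rect// -integral_rect.
- by move=> _ /=; rewrite ltey_eq fin_num_measure.
Qed.

(** Rectangles determine the joint law, whose density with respect to the product
    measure is therefore [phi]. *)
Lemma integral_disintegration (h : (T1 * T2)%type -> R) :
  measurable_fun setT h -> (forall z, 0 <= h z)%R ->
  \int[Q]_z (h z)%:E = \int[m2]_w \int[m1]_v (h (v, w) * phi (v, w))%:E.
Proof.
move=> mh h0; rewrite (integral_density mphi phi_ge0 density mh h0).
rewrite fubini_tonelli2//.
- by apply/measurable_EFinP; exact: measurable_funM.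
- by move=> z; rewrite lee_fin mulr_ge0.
Qed.

End Disintegration.

(** * Convexity, and limits of ratios *)

(** The tangent of the exponential at the mean lies below its graph. *)
Lemma expR_jensen {R : realType} {I : finType} (p a : I -> R) :
  (forall i, 0 <= p i) -> \sum_i p i = 1 ->
  expR (\sum_i p i * a i) <= \sum_i p i * expR (a i).
Proof.
move=> p0 p1; set m := \sum_i _.
have -> : expR m = \sum_i p i * (expR m * (1 + (a i - m))).
  under eq_bigr do rewrite mulrCA mulrDr mulrBr mulr1.
  rewrite -mulr_sumr big_split/= sumrB -mulr_suml p1 -/m.
  by rewrite mul1r subrr addr0 mulr1.
apply: ler_sum => i _; rewrite ler_wpM2l//.
by rewrite -[a i in leRHS](subrK m) expRD mulrC ler_wpM2r ?expR_ge0 ?expR_ge1Dx.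
Qed.

Lemma expR_mul_ln_le {R : realType} (a q : R) : 0 < q -> 0 <= a <= 1 ->
  expR (a * ln q) <= 1 - a + a * q.
Proof.
move=> q0 /andP[a0 a1].
have := @expR_jensen R bool (fun b => if b then a else 1 - a)
  (fun b => if b then ln q else 0).
rewrite !big_bool /= mulr0 addr0 expR0 mulr1 lnK ?posrE// => /(_ _ _).
rewrite [leRHS]addrC; apply; last by rewrite addrC subrK.
by case; rewrite ?subr_ge0.
Qed.

(** Agents whose log-ratios merge have ratios with a common limit, that of their
    average. *)
Lemma cvg_common_limit {R : realType} {N : nat} (z : nat -> 'I_N -> R) (l : R) i :
  (forall j, (fun t => z t j - z t i) @ \oo --> (0 : R)) ->
  (fun t => N%:R^-1 * \sum_j expR (z t j)) @ \oo --> l ->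
  (fun t => expR (z t i)) @ \oo --> l.
Proof.
move=> zi avg.
have N0 : N%:R != 0 :> R by rewrite pnatr_eq0 -lt0n (leq_ltn_trans _ (ltn_ord i)).
have rel : (fun t => N%:R^-1 * \sum_j expR (z t j - z t i)) @ \oo --> (1 : R).
  rewrite [X in _ --> X](_ : _ = N%:R^-1 * \sum_(j < N) expR 0); last first.
    by rewrite expR0 sumr_const card_ord mulVf.
  apply: (cvgM (cvg_cst _)).
  apply: cvg_big => [|j _]; first exact: add_continuous.
  exact: (cvg_comp _ _ (zi j) (@continuous_expR _ _)).
rewrite -[l]divr1.
have -> : (fun t => expR (z t i)) = (fun t => (N%:R^-1 * \sum_j expR (z t j)) /
    (N%:R^-1 * \sum_j expR (z t j - z t i))).
  apply/funext => t.
  have -> : \sum_j expR (z t j) = expR (z t i) * \sum_j expR (z t j - z t i).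
    by rewrite mulr_sumr; apply: eq_bigr => j _; rewrite -expRD addrC subrK.
  rewrite mulrCA mulfK// mulf_neq0 ?invr_eq0//.
  rewrite gt_eqF// (bigD1 i)//= ltr_wpDr ?expR_gt0//.
  by apply: sumr_ge0 => j _; exact: expR_ge0.
by apply: cvgM => //; apply: cvgV => //; exact: oner_neq0.
Qed.

Lemma cvg0_square_summable {R : realType} (a : nat -> R) :
  (forall t, 0 <= a t) -> (\sum_(0 <= t <oo) (a t ^+ 2)%:E < +oo)%E ->
  a @ \oo --> (0 : R).
Proof.
move=> a0 a2.
have /cvgrPdist_lt a20 : (fun t => a t ^+ 2) @ \oo --> (0 : R).
  by apply: cvg_series_cvg_0; apply: nnseries_is_cvg => // t; exact: exprn_ge0.
apply/cvgrPdist_lt => e e0; have := a20 _ (exprn_gt0 2 e0).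
apply: filterS => t; rewrite !sub0r !normrN normrX ltr_pXn2r// nnegrE//.
exact: ltW.
Qed.

(** * The past of the learning process *)

Section History.
Context {R : realType} {N : nat} {n : 'I_N -> nat}
  {d : measure_display} {Omega : measurableType d}.
Variables (x : nat -> Omega -> profile R n) (y : nat -> 'I_N -> Omega -> R).

(** These events generate [history x y t]; they are isolated so that the past is
    itself a measurable space, the sample space with this coarser sigma-algebra. *)
Definition observed_events (t : nat) : set_system Omega :=
  [set A | (exists s i k B, [/\ (s <= t)%N, measurable B
                 & A = (fun w => x s w i 0 k) @^-1` B])
            \/ (exists s i B, [/\ (s < t)%N, measurable B
                 & A = y s i @^-1` B])].

Lemma history_mono s t : (s <= t)%N -> history x y s `<=` history x y t.
Proof.
move=> st; apply: sub_sigma_algebra2 => A [[r [i [k [B [rs mB ->]]]]]|].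
  by left; exists r, i, k, B; split => //; exact: leq_trans rs st.
move=> [r [i [B [rs mB ->]]]].
by right; exists r, i, B; split => //; exact: leq_trans rs st.
Qed.

Notation past t := (g_sigma_algebraType (observed_events t)).

Lemma past_measurable_mono s t d' (T : measurableType d') (h : Omega -> T) :
  (s <= t)%N -> measurable_fun setT (h : past s -> T) ->
  measurable_fun setT (h : past t -> T).
Proof. by move=> st mh _ B mB; apply: (history_mono st); exact: mh. Qed.

Lemma past_measurable_strategy s t i k : (s <= t)%N ->
  measurable_fun setT ((fun w => x s w i 0 k) : past t -> R).
Proof.
move=> st _ B mB; rewrite setTI; apply: sub_sigma_algebra.
by left; exists s, i, k, B.
Qed.

Lemma past_measurable_cost s t i : (s < t)%N ->
  measurable_fun setT (y s i : past t -> R).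
Proof.
move=> st _ B mB; rewrite setTI; apply: sub_sigma_algebra.
by right; exists s, i, B.
Qed.

Hypotheses (mx : forall t i k, measurable_fun setT (fun w => x t w i 0 k))
  (my : forall t i, measurable_fun setT (y t i)).

Lemma history_measurable t : history x y t `<=` measurable.
Proof.
apply: smallest_sub; first exact: sigma_algebra_measurable.
move=> A [[s [i [k [B [_ mB ->]]]]]|[s [i [B [_ mB ->]]]]].
  by rewrite -[X in measurable X]setTI; exact: mx.
by rewrite -[X in measurable X]setTI; exact: my.
Qed.

End History.

Lemma measurable_fun_inv {R : realType} d (T : measurableType d) (h : T -> R) :
  measurable_fun setT h -> (forall w, 0 <= h w) ->
  measurable_fun setT (fun w => (h w)^-1).
Proof.
move=> mh h0; under eq_fun do rewrite -powR_inv1//.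
exact: (measurableT_comp (measurable_powR _)).
Qed.

Section Model.
Context {R : realType} {N : nat} {n : 'I_N -> nat} {Theta : finType}
  {d : measure_display} {Omega : measurableType d}.
Variables (P : probability Omega R) (X : forall i : 'I_N, set 'rV[R]_(n i))
  (u : 'I_N -> profile R n -> Theta -> R)
  (f : 'I_N -> R -> profile R n -> Theta -> R) (W : 'M[R]_N) (alpha : nat -> R)
  (x : nat -> Omega -> profile R n) (y : nat -> 'I_N -> Omega -> R)
  (mu : nat -> 'I_N -> Omega -> Theta -> R) (ts : Theta).
Arguments X : clear implicits.
Hypotheses (X_convex : forall i, convex_set (X i))
  (f_density : cost_densities X u f)
  (f_gt0 : forall i x v k, profiles X x -> cost_values f i x v -> 0 < f i v x k)
  (f_cont : forall i v k, {within profiles X, continuous (fun z => f i v z k)})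
  (alpha_01 : forall t, 0 < alpha t < 1)
  (process : learning_process P X u f W alpha x y mu ts).

Notation past t := (g_sigma_algebraType (observed_events x y t)).

Lemma strategy_in t w : profiles X (x t w).
Proof.
elim: t => [|t IH]; first exact: (strategy_init process).
move=> i; have [z [Xz _] ->] := strategy_update process t i w.
have /andP[a0 a1] := alpha_01 t.
have := @X_convex i z (x t w i) (Itv01 (ltW a0) (ltW a1)).
by rewrite !inE addrC => /(_ Xz (IH i)).
Qed.

Lemma density_ge0 i v t w k : 0 <= f i v (x t w) k.
Proof. by have [] := f_density i k (strategy_in t w). Qed.

Lemma likelihood_mass i t w k : (\int[lebesgue_measure]_v (f i v (x t w) k)%:E = 1)%E.
Proof. by have [] := f_density i k (strategy_in t w). Qed.

Lemma measurable_likelihood i t w k : measurable_fun setT (fun v => f i v (x t w) k).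
Proof. by have [] := f_density i k (strategy_in t w). Qed.

Lemma past_measurable t : history x y t `<=` measurable.
Proof.
exact: (history_measurable (strategy_measurable process)
  (cost_measurable process) (t := t)).
Qed.

Lemma past_measurable_fun t d' (T : measurableType d') (h : Omega -> T) :
  measurable_fun setT (h : past t -> T) -> measurable_fun setT h.
Proof. exact: coarser_measurable_fun (@past_measurable t). Qed.

Lemma past_measurable_likelihood t i k :
  measurable_fun setT ((fun w => f i (y t i w) (x t w) k) : past t.+1 -> R).
Proof.
apply: (@measurable_caratheodory R N n (profiles X) (fun v z => f i v z k)
  _ _ _ (past t.+1) (y t i) (x t)).
- by move=> z Xz; have [] := f_density i k Xz.
- by move=> v; exact: f_cont.
- exact: past_measurable_cost.
- by move=> j l; exact: past_measurable_strategy.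
- exact: strategy_in.
Qed.

Lemma measurable_joint_density t i k :
  measurable_fun setT (fun z : measurableTypeR R * past t => f i z.1 (x t z.2) k).
Proof.
apply: (@measurable_caratheodory R N n (profiles X) (fun v z => f i v z k)
  _ _ _ (measurableTypeR R * past t)%type fst (fun z => x t z.2)).
- by move=> z Xz; have [] := f_density i k Xz.
- by move=> v; exact: f_cont.
- exact: measurable_fst.
- move=> j l; have mxt := @past_measurable_strategy _ _ _ _ _ x y t t j l (leqnn t).
  exact: (measurableT_comp mxt measurable_snd).
- by move=> z; exact: strategy_in.
Qed.

Lemma past_measurable_belief t i k :
  measurable_fun setT ((fun w => mu t i w k) : past t -> R).
Proof.
have mu_ge0 s j w l : 0 <= mu s j w l.
  case: s => [|s]; first by rewrite (belief_init process) invr_ge0.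
  rewrite (belief_update process) divr_ge0 ?expR_ge0//.
  by apply: sumr_ge0 => l' _; exact: expR_ge0.
elim: t i k => [|t IH] i k.
  by under eq_fun do rewrite (belief_init process); exact: measurable_cst.
have mmu j l : measurable_fun setT ((fun w => mu t j w l) : past t.+1 -> R).
  exact: (@past_measurable_mono _ _ _ _ _ x y t t.+1 _ _ _ (leqnSn t)).
have mterm j l : measurable_fun setT ((fun w =>
    f j (y t j w) (x t w) l `^ alpha t * mu t j w l) : past t.+1 -> R).
  apply: measurable_funM; last exact: mmu.
  apply: (measurableT_comp (measurable_powR (alpha t))).
  exact: past_measurable_likelihood.
have mpost j l : measurable_fun setT
    ((fun w => posterior f alpha x y mu t j w l) : past t.+1 -> R).
  apply: measurable_funM; first exact: mterm.
  apply: measurable_fun_inv; first by apply: measurable_sum => l'; exact: mterm.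
  by move=> w; apply: sumr_ge0 => l' _; rewrite mulr_ge0 ?powR_ge0.
have mpool l : measurable_fun setT
    ((fun w => pooled f W alpha x y mu t i w l) : past t.+1 -> R).
  apply: measurableT_comp => //; apply: measurable_sum => j.
  apply: measurable_funM => //; apply: measurableT_comp => //; exact: mpost.
under eq_fun do rewrite (belief_update process).
apply: measurable_funM; first exact: mpool.
apply: measurable_fun_inv; first by apply: measurable_sum => l; exact: mpool.
by move=> w; apply: sumr_ge0 => l _; exact: expR_ge0.
Qed.

(** * Likelihood ratios have conditional mean one *)

Section LikelihoodRatio.
Variables (t : nat) (j : 'I_N).

Let toPast : Omega -> past t := id.

Let mtoPast : measurable_fun setT toPast.
Proof.
by move=> _ B mB; rewrite setTI; exact: past_measurable mB.
Qed.

Let pair w : (measurableTypeR R * past t)%type := (y t j w, toPast w).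

Let mpair : measurable_fun setT pair.
Proof. by apply/measurable_fun_pair => //; exact: (cost_measurable process). Qed.

HB.instance Definition _ := isMeasurableFun.Build _ _ _ _ toPast mtoPast.
HB.instance Definition _ := isMeasurableFun.Build _ _ _ _ pair mpair.

Let law_rect B (A : set (past t)) : measurable B -> measurable A ->
  (distribution P pair (B `*` A) =
  \int[distribution P toPast]_(w in A) \int[lebesgue_measure]_(v in B)
    (f j v (x t w) ts)%:E)%E.
Proof.
move=> mB mA; pose Bs l := if l == j then B else setT.
have mBs l : measurable (Bs l) by rewrite /Bs; case: ifP.
have -> : distribution P pair (B `*` A) =
    P (A `&` [set w | forall l, Bs l (y t l w)]).
  congr (P _); apply/seteqP; split=> w.
    by move=> [Bw Aw]; split => // l; rewrite /Bs; case: eqP => // ->.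
  by move=> [Aw /(_ j)]; rewrite /Bs eqxx; split.
rewrite (cost_law process)//.
rewrite ge0_integral_pushforward//; last 2 first.
- apply: measurable_funTS.
  pose F (z : measurableTypeR R * past t) := (f j z.1 (x t z.2) ts * \1_B z.1)%:E.
  rewrite (_ : (fun w => _) = fubini_G lebesgue_measure F); last first.
    apply/funext => w; rewrite integral_mkcond; apply: eq_integral => v _.
    by rewrite /F patchE indicE /=; case: ifP; rewrite ?mulr1 ?mulr0.
  apply: measurable_fun_fubini_tonelli_G => [|z].
    apply/measurable_EFinP/measurable_funM; first exact: measurable_joint_density.
    by apply: (measurableT_comp (f := \1_B : R -> R)) => //; exact: measurable_indic.
  by rewrite lee_fin mulr_ge0 ?density_ge0.
- by move=> w _; apply: integral_ge0 => v _; rewrite lee_fin density_ge0.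
apply: eq_integral => w _ /=.
rewrite (bigD1 j)//= big1 ?mulr1 => [|l lj].
  rewrite /Bs eqxx /Rintegral fineK// ge0_fin_numE; last first.
    by apply: integral_ge0 => v _; rewrite lee_fin density_ge0.
  rewrite (@le_lt_trans _ _ 1%E) ?ltry// -(likelihood_mass j t w ts).
  apply: ge0_subset_integral => //; last by move=> v _; rewrite lee_fin density_ge0.
  by apply/measurable_EFinP; exact: measurable_likelihood.
by rewrite /Bs (negPf lj) /Rintegral likelihood_mass.
Qed.

(** Given the past, the density of the cost is the likelihood of [ts]. It cancels the
    denominator, and the likelihood of [k] that remains has integral one. For
    [k = ts] this says that the true likelihood of the observed cost is almost
    surely nonzero. *)
Lemma likelihood_ratio_mean k (h : Omega -> R) :
  measurable_fun setT (h : past t -> R) -> (forall w, 0 <= h w) ->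
  (\int[P]_w (h w * (f j (y t j w) (x t w) k / f j (y t j w) (x t w) ts))%:E =
   \int[P]_w (h w)%:E)%E.
Proof.
move=> mh h0.
pose H (z : measurableTypeR R * past t) := h z.2 * (f j z.1 (x t z.2) k / f j z.1 (x t z.2) ts).
have H0 z : 0 <= H z by rewrite mulr_ge0// divr_ge0// density_ge0.
have mH : measurable_fun setT H.
  apply: measurable_funM; first exact: (measurableT_comp mh measurable_snd).
  apply: measurable_funM; first exact: measurable_joint_density.
  apply: measurable_fun_inv; first exact: measurable_joint_density.
  by move=> z; exact: density_ge0.
transitivity (\int[distribution P pair]_z (H z)%:E)%E.
  rewrite ge0_integral_distribution; [by []|exact/measurable_EFinP|].
  by move=> z; rewrite lee_fin.
rewrite (@integral_disintegration _ _ (measurableTypeR R) (past t) R lebesgue_measure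
  (distribution P toPast) (distribution P pair)
  (fun z => f j z.1 (x t z.2) ts)) //; last 2 first.
- exact: measurable_joint_density.
- by move=> z; exact: density_ge0.
rewrite -[RHS](@ge0_integral_distribution _ _ _ _ R P toPast (fun w => (h w)%:E)); last 2 first.
- exact/measurable_EFinP.
- by move=> w; rewrite lee_fin.
apply: eq_integral => w _.
rewrite -[RHS]mule1 -(likelihood_mass j t w k) -ge0_integralZl_EFin//; last 2 first.
- by move=> v _; rewrite lee_fin density_ge0.
- by apply/measurable_EFinP; exact: measurable_likelihood.
apply: eq_integral => v _; rewrite /H /= -EFinM; congr EFin.
rewrite -mulrA; congr *%R.
(* outside the support of the true likelihood all the likelihoods vanish *)
have [f0|f0] := eqVneq (f j v (x t w) ts) 0; last by rewrite divfK.
rewrite f0 mulr0; apply/esym/eqP; rewrite eq_le density_ge0 andbT leNgt.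
apply/negP => fk.
have := f_gt0 ts (strategy_in t w) (ex_intro _ k fk : cost_values f j (x t w) v).
by rewrite f0 ltxx.
Qed.

End LikelihoodRatio.

(** * Belief ratios *)

Definition likelihood_ratio t j w k : R :=
  f j (y t j w) (x t w) k / f j (y t j w) (x t w) ts.

Definition belief_ratio t i w k : R := mu t i w k / mu t i w ts.

(** Outside this almost sure event Bayes' rule divides by zero. *)
Definition supported w := forall t j, 0 < f j (y t j w) (x t w) ts.

Lemma supported_ae : {ae P, forall w, supported w}.
Proof.
apply: ae_foralln => t; apply: filter_forall => j.
pose D := [set w | 0 < f j (y t j w) (x t w) ts].
have mD : measurable D.
  have mft := past_measurable_fun (@past_measurable_likelihood t j ts).
  have mlt : measurable_fun setT (fun w => 0 < f j (y t j w) (x t w) ts).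
    exact: measurable_fun_ltr.
  by have := mlt measurableT [set true] I; rewrite setTI.
have PD : P D = 1%E.
  have := @likelihood_ratio_mean t j ts (fun=> 1) (@measurable_cst _ _ _ _ _ _) (fun=> ler01).
  rewrite integral_cst//= probability_setT mule1 => <-.
  (* as 0 / 0 = 0, the ratio of [ts] to itself is the indicator of [D] *)
  rewrite -[D]setIT -integral_indic//; apply: eq_integral => w _; rewrite mul1r indicE.
  have [Dw|] := boolP (w \in D).
    by rewrite divff// gt_eqF//; rewrite inE in Dw.
  rewrite notin_setE /D /= => /negP; rewrite -leNgt => fle.
  have /eqP -> : f j (y t j w) (x t w) ts == 0 by rewrite eq_le fle density_ge0.
  by rewrite mul0r.
exists (~` D); split; first exact: measurableC.
  by rewrite [LHS](probability_setC P mD) PD subee.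
by [].
Qed.

Lemma belief_gt0 t i w k : 0 < mu t i w k.
Proof.
case: t => [|t].
  by rewrite (belief_init process) invr_gt0 ltr0n; apply/card_gt0P; exists ts.
rewrite (belief_update process) divr_gt0 ?expR_gt0//.
rewrite (bigD1 k)//= ltr_wpDr ?expR_gt0//.
by apply: sumr_ge0 => l _; exact: expR_ge0.
Qed.

Lemma belief_sum t i w : \sum_k mu t i w k = 1.
Proof.
case: t => [|t].
  under eq_bigr do rewrite (belief_init process).
  rewrite sumr_const -[_ *+ _]mulr_natl mulfV// pnatr_eq0 -lt0n.
  by apply/card_gt0P; exists ts.
under eq_bigr do rewrite (belief_update process).
rewrite -mulr_suml mulfV// gt_eqF// (bigD1 ts)//= ltr_wpDr ?expR_gt0//.
by apply: sumr_ge0 => l _; exact: expR_ge0.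
Qed.

Lemma belief_ratio_gt0 t i w k : 0 < belief_ratio t i w k.
Proof. by rewrite divr_gt0 ?belief_gt0. Qed.

Lemma belief_ratioK t i w k :
  mu t i w k = belief_ratio t i w k / \sum_l belief_ratio t i w l.
Proof.
have mu0 : mu t i w ts != 0 by rewrite gt_eqF ?belief_gt0.
by rewrite -mulr_suml belief_sum mul1r invrK divfK.
Qed.

Lemma likelihood_gt0 t j w k : supported w -> 0 < f j (y t j w) (x t w) k.
Proof. by move=> sw; apply: f_gt0; [exact: strategy_in|exists ts; exact: sw]. Qed.

Lemma likelihood_ratio_gt0 t j w k : supported w -> 0 < likelihood_ratio t j w k.
Proof. by move=> sw; rewrite divr_gt0 ?likelihood_gt0. Qed.

(** Bayes' rule adds the log-likelihood ratio to the log-belief ratio, and the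
    geometric pooling of beliefs averages the log-belief ratios. *)
Lemma ln_belief_ratioS t i w k : supported w ->
  ln (belief_ratio t.+1 i w k) =
  \sum_j W i j * (ln (belief_ratio t j w k) + alpha t * ln (likelihood_ratio t j w k)).
Proof.
move=> sw.
have evidence_gt0 j :
    0 < \sum_l f j (y t j w) (x t w) l `^ alpha t * mu t j w l.
  rewrite (bigD1 ts)//= ltr_wpDr ?mulr_gt0 ?powR_gt0 ?likelihood_gt0 ?belief_gt0//.
  by apply: sumr_ge0 => l' _; rewrite mulr_ge0 ?powR_ge0// ltW ?belief_gt0.
have post_gt0 j l : 0 < posterior f alpha x y mu t j w l.
  by rewrite divr_gt0 ?mulr_gt0 ?powR_gt0 ?likelihood_gt0 ?belief_gt0.
have -> : belief_ratio t.+1 i w k =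
    pooled f W alpha x y mu t i w k / pooled f W alpha x y mu t i w ts.
  rewrite /belief_ratio !(belief_update process) invfM invrK mulrACA mulVf ?mulr1//.
  rewrite gt_eqF// (bigD1 ts)//= ltr_wpDr ?expR_gt0//.
  by apply: sumr_ge0 => l _; exact: expR_ge0.
rewrite ln_div ?posrE ?expR_gt0// !expRK -sumrB; apply: eq_bigr => j _.
rewrite -mulrBr -ln_div ?posrE//; congr (_ * _).
rewrite /belief_ratio /likelihood_ratio.
have fk := likelihood_gt0 t j k sw; have fts := likelihood_gt0 t j ts sw.
have muk := belief_gt0 t j w k; have muts := belief_gt0 t j w ts.
have S0 := evidence_gt0 j.
rewrite /posterior !ln_div ?posrE ?mulr_gt0 ?invr_gt0 ?powR_gt0//.
by rewrite !lnM ?posrE ?powR_gt0// !ln_powR; lra.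
Qed.

Variable E : rel 'I_N.
Hypotheses (W_weight : weight_matrix E W) (W_stoch : doubly_stochastic W).

Let W_ge0 i j : 0 <= W i j. Proof. by case: W_weight. Qed.
Let W_row i : \sum_j W i j = 1. Proof. by case: W_stoch. Qed.
Let W_col j : \sum_i W i j = 1. Proof. by case: W_stoch. Qed.

(** A geometric mean is at most the arithmetic mean with the same weights. This
    applies to the pooling of the ratios, and to the power [alpha t] of a likelihood
    ratio, which is its geometric mean with 1. *)
Lemma belief_ratioS_le t i w k : supported w ->
  belief_ratio t.+1 i w k <= \sum_j W i j *
    (belief_ratio t j w k * (1 - alpha t + alpha t * likelihood_ratio t j w k)).
Proof.
move=> sw; rewrite -[leLHS]lnK ?posrE ?belief_ratio_gt0// ln_belief_ratioS//.
apply: le_trans (expR_jensen _ (@W_ge0 i) (W_row i)) _.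
apply: ler_sum => j _; rewrite ler_wpM2l// expRD lnK ?posrE ?belief_ratio_gt0//.
rewrite ler_wpM2l ?(ltW (belief_ratio_gt0 _ _ _ _))//.
have /andP[a0 a1] := alpha_01 t.
by apply: expR_mul_ln_le; rewrite ?likelihood_ratio_gt0// !ltW.
Qed.

Definition mean_ratio k t w : R := N%:R^-1 * \sum_i belief_ratio t i w k.

Lemma mean_ratio_ge0 k t w : 0 <= mean_ratio k t w.
Proof.
rewrite mulr_ge0 ?invr_ge0// sumr_ge0// => i _.
exact: ltW (belief_ratio_gt0 _ _ _ _).
Qed.

Lemma past_measurable_belief_ratio t i k :
  measurable_fun setT ((fun w => belief_ratio t i w k) : past t -> R).
Proof.
apply: measurable_funM; first exact: past_measurable_belief.
apply: measurable_fun_inv; first exact: past_measurable_belief.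
by move=> w; exact: ltW (belief_gt0 _ _ _ _).
Qed.

Lemma past_measurable_mean_ratio k t :
  measurable_fun setT (mean_ratio k t : past t -> R).
Proof.
apply: measurable_funM => //; apply: measurable_sum => i.
exact: past_measurable_belief_ratio.
Qed.

Lemma measurable_likelihood_ratio t j k :
  measurable_fun setT (fun w => likelihood_ratio t j w k).
Proof.
apply: measurable_funM.
  exact: (past_measurable_fun (@past_measurable_likelihood t j k)).
apply: measurable_fun_inv; last by move=> w; exact: density_ge0.
exact: (past_measurable_fun (@past_measurable_likelihood t j ts)).
Qed.

(** The columns of [W] sum to one, so the pooling preserves the mean of the ratios;
    each likelihood ratio has conditional mean one. *)
Lemma mean_ratio_supermartingale k t (A : set Omega) : history x y t A ->
  (\int[P]_(w in A) (mean_ratio k t.+1 w)%:E <=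
   \int[P]_(w in A) (mean_ratio k t w)%:E)%E.
Proof.
move=> hA; have mA : measurable A by exact: past_measurable hA.
have /andP[a0 a1] := alpha_01 t.
pose h j w := \1_A w * (N%:R^-1 * belief_ratio t j w k).
have h0 j w : 0 <= h j w.
  by rewrite mulr_ge0// mulr_ge0 ?invr_ge0// (ltW (belief_ratio_gt0 _ _ _ _)).
have mh j : measurable_fun setT (h j : past t -> R).
  apply: measurable_funM; first exact: (@measurable_indic _ (past t)).
  by apply: measurable_funM => //; exact: past_measurable_belief_ratio.
have mhO j : measurable_fun setT (h j) := past_measurable_fun (@mh j).
have rho0 j w : 0 <= likelihood_ratio t j w k by rewrite divr_ge0 ?density_ge0.
have mhrho j : measurable_fun setT (fun w => h j w * likelihood_ratio t j w k).
  by apply: measurable_funM => //; exact: measurable_likelihood_ratio.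
have onA (g : Omega -> R) :
    (\int[P]_(w in A) (g w)%:E = \int[P]_w (\1_A w * g w)%:E)%E.
  rewrite integral_mkcond; apply: eq_integral => w _.
  by rewrite patchE indicE; case: ifP; rewrite ?mul1r ?mul0r.
rewrite !onA.
apply: (@le_trans _ _ (\int[P]_w (\sum_j ((1 - alpha t) * h j w +
    alpha t * (h j w * likelihood_ratio t j w k)))%:E)%E).
  apply: ae_ge0_le_integral => //.
  - by move=> w _; rewrite lee_fin mulr_ge0// mean_ratio_ge0.
  - apply/measurable_EFinP/measurable_funM => //.
    exact: (past_measurable_fun (@past_measurable_mean_ratio k t.+1)).
  - move=> w _; rewrite lee_fin sumr_ge0// => j _.
    by rewrite addr_ge0// mulr_ge0 ?subr_ge0 ?(ltW a0) ?(ltW a1)// mulr_ge0.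
  - apply/measurable_EFinP/measurable_sum => j.
    by apply: measurable_funD; exact: measurable_funM.
  - apply: filterS supported_ae => w sw _; rewrite lee_fin.
    rewrite (le_trans (ler_wpM2l _ (ler_wpM2l _ (ler_sum (index_enum 'I_N)
      (fun i _ => belief_ratioS_le t i k sw)))))//.
    rewrite exchange_big/= !mulr_sumr le_eqVlt; apply/orP; left; apply/eqP.
    apply: eq_bigr => j _; rewrite -mulr_suml W_col /h; lra.
under eq_integral do rewrite -sumEFin.
rewrite ge0_integral_sum//; last 2 first.
- move=> j; apply/measurable_EFinP.
  by apply: measurable_funD; exact: measurable_funM.
- move=> j w _; rewrite lee_fin.
  by rewrite addr_ge0// mulr_ge0 ?subr_ge0 ?(ltW a0) ?(ltW a1)// mulr_ge0.
have -> : (\int[P]_w (\1_A w * mean_ratio k t w)%:E =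
    \sum_j \int[P]_w (h j w)%:E)%E.
  rewrite -ge0_integral_sum//; last 2 first.
  - by move=> j; exact/measurable_EFinP.
  - by move=> j w _; rewrite lee_fin.
  by apply: eq_integral => w _; rewrite sumEFin /mean_ratio !mulr_sumr.
apply: lee_sum => j _.
under eq_integral do rewrite EFinD EFinM [X in (_ + X)%E]EFinM.
have i0 : (0 <= \int[P]_w (h j w)%:E)%E.
  by apply: integral_ge0 => w _; rewrite lee_fin.
rewrite ge0_integralD//; last 4 first.
- by move=> w _; rewrite mule_ge0// lee_fin// subr_ge0 ltW.
- by apply: measurable_funeM; exact/measurable_EFinP.
- by move=> w _; rewrite mule_ge0// lee_fin ?(ltW a0)// mulr_ge0.
- by apply: measurable_funeM; exact/measurable_EFinP.
rewrite !ge0_integralZl_EFin//; first last.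
- by rewrite subr_ge0 ltW.
- exact/measurable_EFinP.
- by move=> w _; rewrite lee_fin.
- exact: ltW.
- exact/measurable_EFinP.
- by move=> w _; rewrite lee_fin mulr_ge0.
rewrite likelihood_ratio_mean//.
by rewrite -ge0_muleDl ?lee_fin ?subr_ge0 ?(ltW a0) ?(ltW a1)// -EFinD subrK mul1e.
Qed.

Hypothesis N_gt0 : (0 < N)%N.

Lemma mean_ratio_cvg_ae k : {ae P, forall w, cvgn (mean_ratio k ^~ w)}.
Proof.
apply: (@supermartingale_cvg _ _ _ P (observed_events x y)).
- by move=> t; exact: past_measurable.
- by move=> t; exact: history_mono.
- by move=> t w; exact: mean_ratio_ge0.
- by move=> t; exact: past_measurable_mean_ratio.
- by move=> t A; exact: mean_ratio_supermartingale.
- rewrite (_ : (\int[P]_w _ = \int[P]_w 1)%E).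
    by rewrite integral_cst//= probability_setT mule1 ltry.
  apply: eq_integral => w _; congr EFin; rewrite /mean_ratio.
  under eq_bigr => i _.
    rewrite /belief_ratio !(belief_init process) divff; first over.
    by rewrite invr_eq0 pnatr_eq0 -lt0n; apply/card_gt0P; exists ts.
  by rewrite sumr_const card_ord mulVf// pnatr_eq0 -lt0n.
Qed.

(** * Convergence of the beliefs *)

Variable L : R.
Hypotheses (E_sym : symmetric E) (E_connected : connected_graph E)
  (E_nonbip : ~ bipartite E)
  (L_gt0 : 0 < L) (f_bound : log_likelihood_bound X f L)
  (alpha_nincr : nonincreasing_seq alpha)
  (alpha_sqsum : (\sum_(0 <= t <oo) (alpha t ^+ 2)%:E < +oo)%E).

Lemma ln_belief_ratio_merge w k i j : supported w ->
  (fun t => ln (belief_ratio t i w k) - ln (belief_ratio t j w k)) @ \oo --> (0 : R).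
Proof.
move=> sw.
have [p Wp] := weight_matrix_primitive E_sym W_weight W_row E_connected E_nonbip.
apply: (@consensus _ _ W p (fun t i => ln (belief_ratio t i w k))
  (fun t j => alpha t * ln (likelihood_ratio t j w k)) (fun t => alpha t * L)) => //.
- by move=> t l; exact: ln_belief_ratioS.
- by move=> s t st; rewrite ler_wpM2r ?(ltW L_gt0)//; exact: alpha_nincr.
- rewrite -[X in _ --> X](mul0r L); apply: cvgM; last exact: cvg_cst.
  by apply: cvg0_square_summable alpha_sqsum => t; have /andP[/ltW] := alpha_01 t.
- move=> t l; have /andP[a0 _] := alpha_01 t.
  rewrite normrM gtr0_norm// ler_wpM2l ?(ltW a0)//.
  by apply: f_bound; [exact: strategy_in|exists ts; exact: sw].
Qed.

Lemma belief_ratio_cvg w k (l : R) i : supported w -> mean_ratio k ^~ w @ \oo --> l ->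
  (fun t => belief_ratio t i w k) @ \oo --> l.
Proof.
move=> sw ml.
have expK t j : expR (ln (belief_ratio t j w k)) = belief_ratio t j w k.
  by rewrite lnK// posrE belief_ratio_gt0.
rewrite -(funext (expK ^~ i)).
apply: (@cvg_common_limit _ _ (fun t j => ln (belief_ratio t j w k))) => [j|].
  exact: ln_belief_ratio_merge.
by under eq_fun do under eq_bigr do rewrite expK.
Qed.

(** The upper limit exists at every outcome, and [fine] sends an infinite one to 0,
    so that the limit belief is defined, measurable and a probability everywhere. *)
Definition limit_ratio k w : R := fine (limn_esup (fun t => (mean_ratio k t w)%:E)).

Lemma limit_ratioE k w (l : R) : mean_ratio k ^~ w @ \oo --> l -> limit_ratio k w = l.
Proof.
move=> ml; have ml' : (mean_ratio k t w)%:E @[t --> \oo] --> l%:E.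
  by apply: cvg_EFin => //; exact: nearW.
by rewrite /limit_ratio (cvg_limn_einf_sup ml').
Qed.

Lemma measurable_limit_ratio k : measurable_fun setT (limit_ratio k).
Proof.
apply: measurableT_comp => //; apply: measurable_fun_limn_esup => t.
apply/measurable_EFinP.
exact: (past_measurable_fun (@past_measurable_mean_ratio k t)).
Qed.

Lemma limit_ratio_ge0 k w : 0 <= limit_ratio k w.
Proof.
apply: fine_ge0; rewrite limn_esup_lim.
apply: lime_ge; first exact: is_cvg_esups.
apply: nearW => t; apply: (@le_trans _ _ (mean_ratio k t w)%:E).
  by rewrite lee_fin mean_ratio_ge0.
by apply: ereal_sup_ubound; exists t => /=.
Qed.

Lemma limit_ratio_true w : limit_ratio ts w = 1.
Proof.
apply: limit_ratioE; rewrite (_ : mean_ratio ts ^~ w = cst 1); first exact: cvg_cst.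
apply/funext => t; rewrite /mean_ratio /=.
under eq_bigr do rewrite /belief_ratio divff ?gt_eqF ?belief_gt0//.
by rewrite sumr_const card_ord mulVf// pnatr_eq0 -lt0n.
Qed.

Lemma limit_ratio_sum_gt0 w : 0 < \sum_k limit_ratio k w.
Proof.
rewrite (bigD1 ts)//= limit_ratio_true ltr_wpDr ?ltr01//.
by apply: sumr_ge0 => k _; exact: limit_ratio_ge0.
Qed.

Lemma mean_ratio_cvg_limit_ae k :
  {ae P, forall w, mean_ratio k ^~ w @ \oo --> limit_ratio k w}.
Proof.
apply: filterS (mean_ratio_cvg_ae k) => w /cvg_ex[l ml].
by rewrite (limit_ratioE ml).
Qed.

Lemma belief_cvg_ae i : {ae P, forall w, forall k,
  (fun t => mu t i w k) @ \oo --> limit_ratio k w / \sum_l limit_ratio l w}.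
Proof.
have all_cvg : {ae P, forall w, forall k,
    mean_ratio k ^~ w @ \oo --> limit_ratio k w}.
  by apply: filter_forall => k; exact: mean_ratio_cvg_limit_ae.
apply: filterS2 supported_ae all_cvg => w sw mw k.
under eq_fun do rewrite belief_ratioK.
apply: cvgM; first exact: belief_ratio_cvg sw (mw k).
apply: cvgV; first by rewrite gt_eqF ?limit_ratio_sum_gt0.
apply: cvg_big => [|l _]; first exact: add_continuous.
exact: belief_ratio_cvg sw (mw l).
Qed.

End Model.

Unset Implicit Arguments.

Theorem theorem1 (R : realType) (N : nat) (N_gt0 : (0 < N)%N)
    (n : 'I_N -> nat) (X : forall i : 'I_N, set 'rV[R]_(n i))
    (X_convex : forall i, convex_set (X i))
    (X_compact : forall i, compact (X i))
    (Theta : finType) (ts : Theta)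
    (u : 'I_N -> profile R n -> Theta -> R)
    (f : 'I_N -> R -> profile R n -> Theta -> R)
    (f_density : cost_densities X u f)
    (f_gt0 : forall i x v k, profiles X x -> cost_values f i x v ->
       0 < f i v x k)
    (E : rel 'I_N) (E_sym : symmetric E)
    (W : 'M[R]_N) (W_weight : weight_matrix E W)
    (alpha : nat -> R) (alpha_nincr : nonincreasing_seq alpha)
    (d : measure_display) (Omega : measurableType d) (P : probability Omega R)
    (x : nat -> Omega -> profile R n) (y : nat -> 'I_N -> Omega -> R)
    (mu : nat -> 'I_N -> Omega -> Theta -> R)
    (process : learning_process P X u f W alpha x y mu ts)
    (L : R) (L_gt0 : 0 < L) (f_bound : log_likelihood_bound X f L)
    (f_cont : forall i v k, {within profiles X, continuous (fun z => f i v z k)})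
    (E_connected : connected_graph E) (E_nonbip : ~ bipartite E)
    (W_stoch : doubly_stochastic W)
    (alpha_01 : forall t, 0 < alpha t < 1)
    (alpha_sum : (\sum_(0 <= t <oo) (alpha t)%:E = +oo)%E)
    (alpha_sqsum : (\sum_(0 <= t <oo) (alpha t ^+ 2)%:E < +oo)%E) :
  exists nu : Theta -> Omega -> R,
  exists mubar : Omega -> Theta -> R,
  [/\ forall k, measurable_fun setT (nu k) /\ (forall w, 0 <= nu k w),
      forall k, {ae P, forall w,
        (fun t => N%:R^-1 * \sum_i mu t i w k / mu t i w ts) @ \oo --> nu k w},
      (forall k, measurable_fun setT (mubar ^~ k)) /\
        (forall w, beliefs R Theta (mubar w)),
      forall w k, mubar w k = nu k w / \sum_l nu l w
    & forall i, {ae P, forall w, forall k,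
        (fun t => mu t i w k) @ \oo --> mubar w k} ].
Proof.
pose nu k w := limit_ratio mu ts k w.
have nu_ge0 k w : 0 <= nu k w by exact: (limit_ratio_ge0 process k w).
have mnu k : measurable_fun setT (nu k).
  exact: (measurable_limit_ratio X_convex f_density f_cont alpha_01 process k).
have nu_sum w : 0 < \sum_l nu l w by exact: (limit_ratio_sum_gt0 process N_gt0 w).
exists nu, (fun w k => nu k w / \sum_l nu l w); split => //.
- by move=> k; exact: (mean_ratio_cvg_limit_ae X_convex f_density f_gt0 f_cont
    alpha_01 process W_weight W_stoch N_gt0 k).
- split=> [k|w].
    apply: measurable_funM => //; apply: measurable_fun_inv.
      by apply: measurable_sum => l.
    by move=> w; exact: ltW.
  split=> [k|]; first by rewrite divr_ge0// ltW.
  by rewrite -mulr_suml mulfV// gt_eqF.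
- by move=> i; exact: (belief_cvg_ae X_convex f_density f_gt0 f_cont alpha_01
    process W_weight W_stoch N_gt0 E_sym E_connected E_nonbip L_gt0 f_bound
    alpha_nincr alpha_sqsum i).
Qed.
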